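(* Let $(\Gamma,K,\pi)$ be a Markov kernel on a finite graph $\Gamma=(\mathbb V,E)$, with diameter $D$, satisfying conditions (E), (VD), (PI($\theta$)) and (CS($\theta$)) for some $\theta\ge 2$. Let $x,y\in\mathbb V$ be such that $d(x,y)\ge c_0D$ for some $c_0>0$. Then there exist constants $C_1,C_2>0$, depending only on $c_0$, $\theta$ and the constants appearing in the four conditions, such that $$\sum_{0\le n\le 2D^\theta}\frac{C_1}{V(y,n^{1/\theta})}\;\le\; H(x,y)\;\le\;\sum_{0\le n\le 2D^\theta}\frac{C_2}{V(y,n^{1/\theta})},$$ where the sums run over integers $n$. The upper bound is valid, in fact, for all $x,y\in\mathbb V$ (with no condition on $d(x,y)$).
   Context: Setting. $\Gamma=(\mathbb V,E)$ is a finite connected graph with symmetric edge set $E\subset\mathbb V\times\mathbb V$; $x\sim y$ means $(x,y)\in E$; $d$ is the graph distance and $D=\max_{x,y\in\mathbb V}d(x,y)$ is the diameter. A Markov kernel $(\Gamma,K,\pi)$ consists of such a graph, an aperiodic irreducible Markov transition kernel $K:\mathbb V\times\mathbb V\to\mathbb R$, and a probability measure $\pi$ on $\mathbb V$ for which $K$ is reversible, $\pi(x)K(x,y)=\pi(y)K(y,x)$, such that $K(x,y)>0$ if $x\sim y$, and $K(x,y)=0$ if $x\ne y$ and $x\not\sim y$. Balls are $B(x,r)=\{y\in\mathbb V: d(x,y)\le r\}$ and $V(x,r)=\pi(B(x,r))$, $r\ge 0$. Expected hitting time: for the Markov chain $(X_n)_{n\ge0}$ with kernel $K$ and $X_0=x$,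 let $\tau_y=\min\{n\ge0:X_n=y\}$ and $H(x,y)=\mathbb E_x[\tau_y]$. Conditions. (E): there is $p_0>0$ such that $K(x,y)\ge p_0$ for all $x\sim y$. (VD): there is $C_D>0$ such that $V(x,2r)\le C_DV(x,r)$ for all $x\in\mathbb V$, $r>0$. (PI($\theta$)): there is $C_P>0$ such that for all $x\in\mathbb V$, $r>0$, with $B=B(x,r)$, all $f:\mathbb V\to\mathbb R$ and $f_B=\pi(B)^{-1}\sum_{z\in B}f(z)\pi(z)$, $$\sum_{z\in B}|f(z)-f_B|^2\pi(z)\le C_Pr^\theta\sum_{\xi,\zeta\in B,\ \xi\sim\zeta}|f(\xi)-f(\zeta)|^2K(\xi,\zeta)\pi(\xi).$$ (CS($\theta$)): there are constants $C_1',C_2',\epsilon>0$ such that for any $x\in\mathbb V$, $r>0$ there is a function $\sigma=\sigma_{x,r}:\mathbb V\to\mathbb R$ with: (a) $\sigma\ge1$ on $B(x,r/2)$; (b) $\sigma\equiv0$ on $\mathbb V\setminus B(x,r)$; (c) $|\sigma(z)-\sigma(y)|\le C_1'(d(z,y)/r)^\epsilon$ for all $y,z\in\mathbb V$; (d) for any $s\in(0,r]$ and any function $f$ on $B(x,2r)$, $$\sum_{z\in B(x,s)}|f(z)|^2\sum_{y\sim z}|\sigma(z)-\sigma(y)|^2K(z,y)\pi(z)\le C_2'\Big(\frac sr\Big)^{2\epsilon}\Big\{\sum_{z,y\in B(x,2s),\,z\sim y}|f(z)-f(y)|^2K(z,y)\pi(z)+s^{-\theta}\sum_{z\in B(x,2s)}|f(z)|^2\pi(z)\Big\}.$$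 Convention on constants: the constants in the conclusion do not depend on any other parameter, such as the size or diameter of the graph, or the points $x,y$.
   Formalization: The lower bound is stated for D > 0 (at least two vertices), since for the one-vertex graph H(x,x) = 0 while the sum on the left equals C_1 > 0; the upper bound has no such restriction. *)

(* Defs.v *)
From HB Require Import structures.
From mathcomp Require Import all_boot all_order all_algebra.
From mathcomp Require Import all_classical all_reals all_analysis.

Set Implicit Arguments.
Unset Strict Implicit.
Unset Printing Implicit Defensive.

Import Order.TTheory GRing.Theory Num.Theory.
Import numFieldNormedType.Exports.

Local Open Scope classical_set_scope.
Local Open Scope ring_scope.

(* Graph distance: the least length of an e-path from x to y.  A shortest path
   has length < #|V|; the junk value #|V| is returned when y is not reachable
   from x, which never happens in a connected graph. *)
Definition gdist (V : finType) (e : rel V) (x y : V) : nat :=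
  find (fun n => [exists p : n.-tuple V, path e x p && (last x p == y)])
       (iota 0 #|V|).

Definition gdiam (V : finType) (e : rel V) : nat :=
  (\max_(x : V) \max_(y : V) gdist e x y)%N.

Definition gball (R : realType) (V : finType) (e : rel V) (x : V) (r : R) :
  {set V} := [set y | (gdist e x y)%:R <= r]%SET.

Definition gvol (R : realType) (V : finType) (e : rel V) (pi : V -> R)
    (x : V) (r : R) : R :=
  \sum_(z in gball e x r) pi z.

Fixpoint kernel_iter (R : realType) (V : finType) (K : V -> V -> R)
    (n : nat) (x y : V) : R :=
  if n is n'.+1 then \sum_(z : V) K x z * kernel_iter K n' z y
  else (x == y)%:R.

Definition irreducible_kernel (R : realType) (V : finType)
    (K : V -> V -> R) : Prop :=
  forall x y, exists n, 0 < kernel_iter K n x y.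

(* gcd {n >= 1 | K^n(x, x) > 0} = 1 for every x *)
Definition aperiodic_kernel (R : realType) (V : finType)
    (K : V -> V -> R) : Prop :=
  forall (x : V) (g : nat),
    (forall n, (0 < n)%N -> 0 < kernel_iter K n x x -> (g %| n)%N) -> g = 1%N.

(* The edge relation is not required to be irreflexive, and K x x may be
   positive whether or not e x x holds. *)
Record markov_kernel (R : realType) (V : finType) (e : rel V)
    (K : V -> V -> R) (pi : V -> R) : Prop := MarkovKernel {
  mk_edge_sym : symmetric e;
  mk_connected : forall x y, connect e x y;
  mk_ge0 : forall x y, 0 <= K x y;
  mk_sum1 : forall x, \sum_(y : V) K x y = 1;
  mk_irreducible : irreducible_kernel K;
  mk_aperiodic : aperiodic_kernel K;
  mk_pi_ge0 : forall x, 0 <= pi x;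
  mk_pi_sum1 : \sum_(x : V) pi x = 1;
  mk_reversible : forall x y, pi x * K x y = pi y * K y x;
  mk_edge_gt0 : forall x y, e x y -> 0 < K x y;
  mk_nonedge_eq0 : forall x y, x != y -> ~~ e x y -> K x y = 0
}.

Definition condE (R : realType) (V : finType) (e : rel V) (K : V -> V -> R)
    (p0 : R) : Prop :=
  forall x y, e x y -> p0 <= K x y.

Definition condVD (R : realType) (V : finType) (e : rel V) (pi : V -> R)
    (CD : R) : Prop :=
  forall x (r : R), 0 < r -> gvol e pi x (2 * r) <= CD * gvol e pi x r.

Definition ball_mean (R : realType) (V : finType) (e : rel V) (pi : V -> R)
    (x : V) (r : R) (f : V -> R) : R :=
  (gvol e pi x r)^-1 * \sum_(z in gball e x r) f z * pi z.

Definition condPI (R : realType) (V : finType) (e : rel V) (K : V -> V -> R)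
    (pi : V -> R) (theta CP : R) : Prop :=
  forall x (r : R), 0 < r -> forall f : V -> R,
    \sum_(z in gball e x r) `|f z - ball_mean e pi x r f| ^+ 2 * pi z <=
    CP * r `^ theta *
      \sum_(xi in gball e x r) \sum_(zeta in gball e x r | e xi zeta)
        `|f xi - f zeta| ^+ 2 * K xi zeta * pi xi.

(* In the last clause f is taken on all of V; only its values on
   B(x, 2s), a subset of B(x, 2r), occur. *)
Definition condCS (R : realType) (V : finType) (e : rel V) (K : V -> V -> R)
    (pi : V -> R) (theta C1' C2' eps : R) : Prop :=
  forall x (r : R), 0 < r -> exists sigma : V -> R,
    [/\ forall z, z \in gball e x (r / 2) -> 1 <= sigma z,
        forall z, z \notin gball e x r -> sigma z = 0,
        forall y z,
          `|sigma z - sigma y| <= C1' * ((gdist e z y)%:R / r) `^ eps &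
        forall s : R, 0 < s -> s <= r -> forall f : V -> R,
          \sum_(z in gball e x s) (`|f z| ^+ 2 *
            \sum_(y : V | e y z) `|sigma z - sigma y| ^+ 2 * K z y * pi z) <=
          C2' * (s / r) `^ (2 * eps) *
            (\sum_(z in gball e x (2 * s))
               \sum_(y in gball e x (2 * s) | e z y)
                 `|f z - f y| ^+ 2 * K z y * pi z +
             s `^ (- theta) *
               \sum_(z in gball e x (2 * s)) `|f z| ^+ 2 * pi z)].

(* X is a Markov chain with kernel K started at x; the Markov property is
   conditional on the whole past, with the conditioning event multiplied out
   so that it may have probability zero. *)
Definition markov_chain (R : realType) (V : finType) (K : V -> V -> R)
    (d : measure_display) (T : measurableType d) (P : probability T R)
    (X : nat -> T -> V) (x : V) : Prop :=
  [/\ forall n v, measurable [set w | X n w = v],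
      P [set w | X 0%N w = x] = 1%E &
      forall (n : nat) (p : nat -> V),
        P [set w | forall i, (i <= n.+1)%N -> X i w = p i] =
        (P [set w | forall i, (i <= n)%N -> X i w = p i] *
           (K (p n) (p n.+1))%:E)%E].

(* +oo if y is never hit *)
Definition hitting_time (R : realType) (V : finType) (T : Type)
    (X : nat -> T -> V) (y : V) (w : T) : \bar R :=
  ereal_inf [set (n%:R)%:E | n in [set n : nat | X n w = y]].

Definition expected_hitting_time (R : realType) (V : finType)
    (d : measure_display) (T : measurableType d) (P : probability T R)
    (X : nat -> T -> V) (y : V) : \bar R :=
  (\int[P]_w hitting_time R X y w)%E.

(* Sum of C / V(y, n^(1/theta)) over the integers 0 <= n <= 2 D^theta. *)
Definition volume_sum (R : realType) (V : finType) (e : rel V) (pi : V -> R)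
    (theta C : R) (y : V) : R :=
  \sum_(0 <= n < (Num.truncn (2 * (gdiam e)%:R `^ theta)).+1)
    C / gvol e pi y (n%:R `^ theta^-1).

(* Main.v *)
Require Import Defs.
From HB Require Import structures.
From mathcomp Require Import all_boot all_order all_algebra.
From mathcomp Require Import all_classical all_reals all_analysis measurable_realfun.
From mathcomp Require Import ring lra.

Set Implicit Arguments.
Unset Strict Implicit.
Unset Printing Implicit Defensive.

Import Order.TTheory GRing.Theory Num.Theory.
Import numFieldNormedType.Exports.

Local Open Scope classical_set_scope.
Local Open Scope ring_scope.

(** Write c(z,u) = pi(z) K(z,u), let E(f,g) be the sum over all pairs (z,u) of
    (f z - f u)(g z - g u) c(z,u), and let h(z) be the expected time to hit y
    from z.  Then h(y) = 0 and h = 1 + K h off y, so that h is the potential of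
    a unit flow entering uniformly and leaving at y:
    E(h,f) = 2 (mean of f - f(y)) for every f (hitting_dirichlet).
    The volume sum is comparable to T + D^theta, where T is the sum over
    4^k <= D of 4^(k theta) / V(y,4^k); the k-th term is the order of the
    effective resistance of the annulus of radius 4^k around y.

    Upper bound.  Between the heights a and b the function h has energy at most
    2(b-a) (layer_energy).  By the Poincare inequality, h therefore cannot rise
    from one ball B(y,4^k) to the next by more than the resistance of the
    annulus, except on a small part of the ball (poincare_two_sets,
    hitting_chain).  This gives h <= C T + C D^theta on half of the graph.  A
    De Giorgi iteration (faber_krahn, de_giorgi) turns this into a bound
    everywhere, at the cost of another multiple of D^theta.  The argument only
    uses h <= 1 + K h, which the truncated expectations of min(tau,N) satisfy
    too; so it also proves that h is finite.

    Lower bound.  Two estimates show that h is large on half of a ball around x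
    of radius comparable to D.  Cutoff functions around y, stacked with heights
    equal to the resistances of the annuli, have energy of order T; tested
    against h they give mean(h) >= c T as soon as T is much larger than D^theta
    (stacked_cutoffs, hitting_mean_ge).  Since h <= C T, a definite part of the
    graph has h >= c T, and the Poincare inequality at scale D passes this on
    to the ball (hitting_large_on_half).  If instead T is at most of order
    D^theta, one tests h with sigma^2/h, where sigma is a cutoff around x, and
    finds that the mean of 1/h near x is at most of order D^-theta
    (hitting_log_energy, hitting_large_local).

    To pass from half of a ball to the point x one needs a weak Harnack
    inequality (hitting_weak_harnack).  The positive part of ln(lambda/h) is a
    subsolution away from y; it vanishes on half of the ball, and the same test
    function bounds its energy, hence its mean square.  De Giorgi's iteration
    bounds its value at x.  The iteration requires a Caccioppoli inequality
    between balls of arbitrarily close radii.  The cutoff condition does not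
    give this directly: its right-hand side contains the energy of f with a
    constant that is not small.  Averaging the cutoffs of small balls produces
    a cutoff whose right-hand side only contains the energy in a thin annulus
    (annular_cutoff), and Widman's hole-filling trick absorbs it
    (hole_filling, caccioppoli). *)

(** * The graph distance *)

Section GraphDistance.

Variables (V : finType) (e : rel V).
Hypothesis e_sym : symmetric e.
Hypothesis e_conn : forall x y, connect e x y.

Lemma gdist_path x y :
  exists2 p : seq V, path e x p & last x p = y /\ size p = gdist e x y.
Proof.
set a := fun n => [exists p : n.-tuple V, path e x p && (last x p == y)].
have hasa : has a (iota 0 #|V|).
  case/connectP: (e_conn x y) => p0 /shortenP[p pth up _] yE.
  apply/hasP; exists (size p); last first.
    by apply/existsP; exists (in_tuple p); rewrite /= pth -yE eqxx.
  rewrite mem_iota add0n /=.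
  by have := max_card (mem (x :: p)); rewrite (card_uniqP up).
have := nth_find 0%N hasa; rewrite -/(gdist e x y).
rewrite nth_iota ?add0n; last by rewrite has_find size_iota in hasa.
by case/existsP=> p /andP[pth /eqP yE]; exists p => //; rewrite size_tuple.
Qed.

Lemma gdist_le_size x p : path e x p -> (gdist e x (last x p) <= size p)%N.
Proof.
move=> pth; rewrite leqNgt; apply/negP => lt_pd.
have lt_pV : (size p < #|V|)%N.
  by apply: (leq_trans lt_pd); rewrite -[#|V|](size_iota 0) find_size.
have := before_find 0%N lt_pd; rewrite nth_iota // add0n.
by move/existsP; apply; exists (in_tuple p); rewrite /= pth eqxx.
Qed.

Lemma gdist_refl x : gdist e x x = 0%N.
Proof. by apply/eqP; rewrite -leqn0 (@gdist_le_size x [::]). Qed.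

Lemma gdist_eq0 x y : gdist e x y = 0%N -> x = y.
Proof.
move=> d0; have [p _ []] := gdist_path x y.
by rewrite d0 => <- /size0nil ->.
Qed.

Lemma gdist_triangle x y z : (gdist e x z <= gdist e x y + gdist e y z)%N.
Proof.
have [p pp [<- <-]] := gdist_path x y.
have [q pq [<- <-]] := gdist_path (last x p) z.
by rewrite -size_cat -last_cat gdist_le_size // cat_path pp.
Qed.

Lemma gdist_edge x y : e x y -> (gdist e x y <= 1)%N.
Proof. by move=> exy; apply: (@gdist_le_size x [:: y]); rewrite /= exy. Qed.

Lemma gdist_sym x y : gdist e x y = gdist e y x.
Proof.
suff le_d u v : (gdist e u v <= gdist e v u)%N by apply/eqP; rewrite eqn_leq !le_d.
have [p pp [lp <-]] := gdist_path v u.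
have := rev_path e v p; rewrite (@eq_path _ _ e) => [|a b]; last exact: e_sym.
rewrite pp lp => /gdist_le_size; rewrite size_rev size_belast.
case: p pp lp => [|a p] _ lp /=; first by rewrite -lp gdist_refl.
by rewrite rev_cons last_rcons.
Qed.

Lemma gdist_le_diam x y : (gdist e x y <= gdiam e)%N.
Proof.
apply: leq_trans (leq_bigmax x).
exact: (leq_bigmax (F := fun y => gdist e x y) y).
Qed.

End GraphDistance.


(** * Weighted sums and clipping *)

Lemma sum_cauchy_schwarz (R : realType) (I : finType) (w a b : I -> R) :
  (forall i, 0 <= w i) ->
  (\sum_i a i * b i * w i) ^+ 2 <=
  (\sum_i a i ^+ 2 * w i) * (\sum_i b i ^+ 2 * w i).
Proof.
move=> w0; set C := \sum_i _ * _ * _; set A := \sum_i _ * _; set B := \sum_i _ * _.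
have B0 : 0 <= B by apply: sumr_ge0 => i _; rewrite mulr_ge0 ?sqr_ge0.
have [B0e|Bn0] := eqVneq B 0.
  have bw i : b i * w i = 0.
    have /eqP := psumr_eq0P (fun i _ => mulr_ge0 (sqr_ge0 (b i)) (w0 i)) B0e (i := i) isT.
    rewrite mulf_eq0 sqrf_eq0 => /orP[] /eqP ->; by rewrite ?mul0r ?mulr0.
  have -> : C = 0 by apply: big1 => i _; rewrite -mulrA bw mulr0.
  by rewrite expr0n /= B0e mulr0.
have Bp : 0 < B by rewrite lt_def Bn0.
have : 0 <= \sum_i (a i * B - b i * C) ^+ 2 * w i.
  by apply: sumr_ge0 => i _; rewrite mulr_ge0 ?sqr_ge0.
have -> : \sum_i (a i * B - b i * C) ^+ 2 * w i = B * (A * B - C ^+ 2).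
  rewrite (eq_bigr (fun i => B ^+ 2 * (a i ^+ 2 * w i) +
      - (2 * B * C) * (a i * b i * w i) + C ^+ 2 * (b i ^+ 2 * w i))); last first.
    by move=> i _; ring.
  rewrite !big_split /= -!mulr_sumr -/A -/B -/C; ring.
by rewrite pmulr_rge0 // subr_ge0.
Qed.

(** Truncations lower the energy, and a truncation of f tested against f
    itself controls its own energy (the two contraction lemmas). *)
Section Clip.

Variable R : realType.
Implicit Types a b s t : R.

Definition clip a b t : R := Num.max a (Num.min t b).

Definition pos_part t : R := Num.max t 0.

Lemma clip_ge a b t : a <= clip a b t.
Proof. by rewrite /clip le_max lexx. Qed.

Lemma clip_le a b t : a <= b -> clip a b t <= b.
Proof. by move=> ab; rewrite /clip ge_max ab ge_min lexx orbT. Qed.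

Lemma clip_low a b t : a <= b -> t <= a -> clip a b t = a.
Proof.
by move=> ab ta; rewrite /clip min_l ?max_l //; apply: le_trans ab.
Qed.

Lemma clip_high a b t : a <= b -> b <= t -> clip a b t = b.
Proof. by move=> ab bt; rewrite /clip min_r ?max_r. Qed.

Lemma clip_contract a b s t :
  (clip a b s - clip a b t) ^+ 2 <= (s - t) * (clip a b s - clip a b t).
Proof.
rewrite /clip /Num.max /Num.min.
by do 2!case: (ltP s b) => ?; do 2!case: (ltP t b) => ?;
  repeat case: ifPn; rewrite -?leNgt => *; nra.
Qed.

Lemma clip_lip a b s t : (clip a b s - clip a b t) ^+ 2 <= (s - t) ^+ 2.
Proof.
have := clip_contract a b s t; set u := clip a b s - _; set v := s - t => uv.
have : 0 <= (u - v) ^+ 2 by apply: sqr_ge0.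
nra.
Qed.

Lemma pos_part_ge0 t : 0 <= pos_part t.
Proof. by rewrite /pos_part le_max lexx orbT. Qed.

Lemma pos_part_ge t : t <= pos_part t.
Proof. by rewrite /pos_part le_max lexx. Qed.

Lemma pos_part_eq0 t : t <= 0 -> pos_part t = 0.
Proof. by move=> t0; rewrite /pos_part max_r. Qed.

Lemma pos_part_id t : 0 <= t -> pos_part t = t.
Proof. by move=> t0; rewrite /pos_part max_l. Qed.

Lemma pos_part_contract s t :
  (pos_part s - pos_part t) ^+ 2 <= (s - t) * (pos_part s - pos_part t).
Proof.
rewrite /pos_part /Num.max.
by repeat case: ifPn; rewrite -?leNgt => *; nra.
Qed.

Lemma pos_part_lip s t : (pos_part s - pos_part t) ^+ 2 <= (s - t) ^+ 2.
Proof.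
have := pos_part_contract s t; set u := pos_part s - _; set v := s - t => uv.
have : 0 <= (u - v) ^+ 2 by apply: sqr_ge0.
nra.
Qed.

End Clip.

(** * Conductances and energies *)

Section Energy.

Variables (R : realType) (V : finType) (e : rel V).
Variables (K : V -> V -> R) (pi : V -> R).
Hypothesis mk : markov_kernel e K pi.

Implicit Types (x y z u : V) (f g : V -> R) (A B : {set V}).

Definition conductance z u : R := pi z * K z u.

Definition markov_op f z : R := \sum_u K z u * f u.

Definition energy_on A f : R :=
  \sum_(z in A) \sum_(u in A) (f z - f u) ^+ 2 * conductance z u.

Definition dirichlet f g : R :=
  \sum_z \sum_u (f z - f u) * (g z - g u) * conductance z u.

(** Reversibility propagates a zero of pi along the edges of the connected
    graph, and pi has total mass 1. *)
Lemma stationary_gt0 z : 0 < pi z.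
Proof.
have [z0 pz0] : exists z0, 0 < pi z0.
  apply: contrapT => /forallNP pi0.
  have : \sum_z pi z = 0.
    apply: big1 => x _; apply/eqP; rewrite eq_le (mk_pi_ge0 mk x) andbT leNgt.
    exact/negP/pi0.
  by rewrite (mk_pi_sum1 mk) => /eqP; rewrite oner_eq0.
case/connectP: (mk_connected mk z0 z) => p pth ->.
elim: p z0 pz0 pth => //= a p IH z0 pz0 /andP[ea pth]; apply: IH => //.
have : 0 < pi a * K a z0.
  by rewrite -(mk_reversible mk) mulr_gt0 // (mk_edge_gt0 mk).
move=> pK; rewrite lt_def (mk_pi_ge0 mk a) andbT.
by apply: contraTneq pK => ->; rewrite mul0r ltxx.
Qed.

Lemma conductance_sym z u : conductance z u = conductance u z.
Proof. exact: (mk_reversible mk). Qed.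

Lemma conductance_ge0 z u : 0 <= conductance z u.
Proof. by rewrite mulr_ge0 ?(mk_ge0 mk) ?(mk_pi_ge0 mk). Qed.

Lemma conductance_sum z : \sum_u conductance z u = pi z.
Proof. by rewrite -mulr_sumr (mk_sum1 mk) mulr1. Qed.

Lemma conductance_sumr z : \sum_u conductance u z = pi z.
Proof. by rewrite -conductance_sum; apply: eq_bigr => u _; apply: conductance_sym. Qed.

Lemma conductance_gdist z u : conductance z u != 0 -> (gdist e z u <= 1)%N.
Proof.
move=> c0; have [->|zu] := eqVneq z u; first by rewrite gdist_refl.
apply: gdist_edge; apply: contraNT c0 => ezu.
by rewrite /conductance (mk_nonedge_eq0 mk) // mulr0.
Qed.

Lemma energy_on_ge0 A f : 0 <= energy_on A f.
Proof.
by do 2!apply: sumr_ge0 => ? _; rewrite mulr_ge0 ?sqr_ge0 ?conductance_ge0.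
Qed.

Lemma energy_onT f : energy_on [set: V]%SET f = dirichlet f f.
Proof.
apply: eq_big => [z|z _]; first by rewrite finset.in_setT.
by apply: eq_big => [u|u _]; rewrite ?finset.in_setT.
Qed.

Lemma energy_on_le A f g :
  (forall z u, z \in A -> u \in A -> (f z - f u) ^+ 2 <= (g z - g u) ^+ 2) ->
  energy_on A f <= energy_on A g.
Proof.
move=> fg; do 2!apply: ler_sum => ? ?.
by rewrite ler_wpM2r ?conductance_ge0 ?fg.
Qed.

Lemma energy_on_subset A B f : {subset A <= B} -> energy_on A f <= energy_on B f.
Proof.
move=> AB; rewrite /energy_on.
under [leLHS]eq_bigr do rewrite big_mkcond.
under [leRHS]eq_bigr do rewrite big_mkcond.
rewrite big_mkcond [leRHS]big_mkcond; apply: ler_sum => z _.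
have t0 u : 0 <= (f z - f u) ^+ 2 * conductance z u.
  by rewrite mulr_ge0 ?sqr_ge0 ?conductance_ge0.
case: ifPn => [/AB -> | _]; last first.
  by case: ifP => // _; apply: sumr_ge0 => u _; case: ifP.
by apply: ler_sum => u _; case: ifPn => [/AB -> //|_]; case: ifP.
Qed.

Lemma energy_on_dirichlet A f : energy_on A f <= dirichlet f f.
Proof. by rewrite -energy_onT energy_on_subset // => z _; rewrite finset.in_setT. Qed.

Lemma dirichlet_cauchy_schwarz f g :
  dirichlet f g ^+ 2 <= dirichlet f f * dirichlet g g.
Proof.
rewrite /dirichlet !pair_big /=.
have := @sum_cauchy_schwarz R _ (fun p : V * V => conductance p.1 p.2)
  (fun p => f p.1 - f p.2) (fun p => g p.1 - g p.2)
  (fun p => conductance_ge0 _ _).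
by congr (_ <= _ * _); apply: eq_bigr => p _; rewrite expr2.
Qed.

(** Summation by parts: it turns a pointwise inequality such as f <= 1 + K f
    into an energy inequality. *)
Lemma dirichletE f g :
  dirichlet f g = 2 * \sum_z g z * (f z - markov_op f z) * pi z.
Proof.
pose T := \sum_z \sum_u (f z - f u) * g z * conductance z u.
have -> : dirichlet f g = T + T.
  rewrite {2}/T exchange_big /= -big_split /=; apply: eq_bigr => z _.
  rewrite -big_split /=; apply: eq_bigr => u _.
  by rewrite [conductance u z]conductance_sym; ring.
rewrite -mulr2n -[LHS]mulr_natl; congr (_ * _); apply: eq_bigr => z _.
transitivity (g z * (f z * \sum_u conductance z u - \sum_u conductance z u * f u)).
  rewrite mulrBr !mulr_sumr -sumrB; apply: eq_bigr => u _; ring.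
rewrite conductance_sum.
have -> : \sum_u conductance z u * f u = pi z * markov_op f z.
  by rewrite /markov_op mulr_sumr; apply: eq_bigr => u _; rewrite mulrA.
ring.
Qed.

End Energy.

(** * Balls and volumes *)

Section Volumes.

Variables (R : realType) (V : finType) (e : rel V).
Variables (K : V -> V -> R) (pi : V -> R).
Hypothesis mk : markov_kernel e K pi.

Implicit Types (x y z u : V) (r s : R) (f : V -> R).

Local Notation ball := (gball e).
Local Notation vol := (gvol e pi).

Lemma in_gball x r z : (z \in ball x r) = ((gdist e x z)%:R <= r).
Proof. by rewrite inE. Qed.

Lemma gball_center x r : 0 <= r -> x \in ball x r.
Proof. by rewrite in_gball gdist_refl. Qed.

Lemma gball_sym x z r : (z \in ball x r) = (x \in ball z r).
Proof. by rewrite !in_gball (gdist_sym (mk_edge_sym mk) (mk_connected mk)). Qed.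

Lemma gball_trans x z u r s t :
  r + s <= t -> z \in ball x r -> u \in ball z s -> u \in ball x t.
Proof.
rewrite !in_gball => rst xz zu; apply: le_trans (le_trans (lerD xz zu) rst).
by rewrite -natrD ler_nat gdist_triangle //; exact: (mk_connected mk).
Qed.

Lemma gball_le x r s : r <= s -> {subset ball x r <= ball x s}.
Proof. by move=> rs z; rewrite !in_gball => /le_trans; apply. Qed.

Lemma gball_small x r z : r < 1 -> z \in ball x r -> z = x.
Proof.
rewrite in_gball => r1 xz; apply/esym/gdist_eq0; first exact: (mk_connected mk).
by apply/eqP; rewrite -leqn0 -ltnS -(ltr_nat R); apply: le_lt_trans r1.
Qed.

Lemma gball_diam x r z : (gdiam e)%:R <= r -> z \in ball x r.
Proof.
by rewrite in_gball => /(le_trans _); apply; rewrite ler_nat gdist_le_diam.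
Qed.

Lemma gball_neighbour x r z u :
  z \in ball x r -> conductance K pi z u != 0 -> u \in ball x (r + 1).
Proof.
move=> xz /(conductance_gdist mk) zu; apply: gball_trans xz _ => //.
by rewrite in_gball lern1.
Qed.

Lemma gvol_gt0 x r : 0 <= r -> 0 < vol x r.
Proof.
move=> r0; rewrite /gvol (bigD1 x) ?gball_center //=.
apply: (lt_le_trans (stationary_gt0 mk x)); rewrite lerDl; apply: sumr_ge0 => z _.
exact/ltW/(stationary_gt0 mk).
Qed.

Lemma gvol_sub x y r s : {subset ball x r <= ball y s} -> vol x r <= vol y s.
Proof.
move=> sub; rewrite /gvol [leLHS]big_mkcond [leRHS]big_mkcond.
apply: ler_sum => z _; case: ifPn => [/sub -> //|_].
by case: ifP; rewrite // ltW ?(stationary_gt0 mk).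
Qed.

Lemma gvol_mono x r s : r <= s -> vol x r <= vol x s.
Proof. by move=> rs; apply/gvol_sub/gball_le. Qed.

Lemma gvol_full x r : (gdiam e)%:R <= r -> vol x r = 1.
Proof.
move=> Dr; rewrite -(mk_pi_sum1 mk) /gvol.
by apply: eq_bigl => z; rewrite gball_diam.
Qed.

Lemma gvol_le1 x r : vol x r <= 1.
Proof.
by rewrite -(@gvol_full x (Num.max r (gdiam e)%:R)) ?gvol_mono // le_max lexx ?orbT.
Qed.

Lemma gvol_small x r : 0 <= r -> r < 1 -> vol x r = pi x.
Proof.
move=> r0 r1; rewrite /gvol (bigD1 x) ?gball_center //= big1 ?addr0 //.
by move=> z /andP[/(gball_small r1) -> /eqP].
Qed.

Variable CD : R.
Hypothesis vd : condVD e pi CD.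

Lemma doubling_ge1 x : 1 <= CD.
Proof.
rewrite -(ler_pM2r (@gvol_gt0 x 1 ler01)) mul1r.
by apply: le_trans (vd x ltr01); apply: gvol_mono; lra.
Qed.

Lemma doubling_gt0 x : 0 < CD.
Proof. exact: lt_le_trans (doubling_ge1 x). Qed.

Lemma gvol_doubling x r n : 0 < r -> vol x (2 ^+ n * r) <= CD ^+ n * vol x r.
Proof.
move=> r0; elim: n => [|n IH]; first by rewrite !expr0 !mul1r.
rewrite !exprS -!mulrA; apply: le_trans (vd _ _) _; first by rewrite mulr_gt0 ?exprn_gt0.
by rewrite ler_pM2l // (doubling_gt0 x).
Qed.

Lemma gvol_comparable x y r s n :
  0 < r -> {subset ball y s <= ball x (2 ^+ n * r)} ->
  vol y s <= CD ^+ n * vol x r.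
Proof. by move=> r0 /gvol_sub /le_trans; apply; apply: gvol_doubling. Qed.

Lemma gvol_comparable1 x y r s t :
  0 < r -> t <= r -> s + t <= 2 * r -> y \in ball x t -> vol y s <= CD * vol x r.
Proof.
move=> r0 tr str yx; rewrite -[CD]expr1; apply: gvol_comparable => // z zy.
by rewrite expr1; apply: gball_trans yx zy; rewrite addrC.
Qed.

(** In a doubling space the average of the balls B(z,s), each weighted by
    pi(z)/V(z,s), covers every point a bounded number of times from above and
    from below; these averages replace a covering of bounded overlap. *)
Lemma cover_le a s : 0 < s -> \sum_(z in ball a s) pi z / vol z s <= CD.
Proof.
move=> s0; have va : 0 < vol a s by rewrite gvol_gt0 // ltW.
apply: (@le_trans _ _ (\sum_(z in ball a s) pi z * (CD / vol a s))).
  apply: ler_sum => z za; rewrite ler_pM2l ?(stationary_gt0 mk) //.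
  rewrite ler_pdivlMr // mulrC ler_pdivrMr ?gvol_gt0 ?(ltW s0) //.
  by apply: (@gvol_comparable1 _ _ _ _ s); rewrite // -1?gball_sym //; lra.
by rewrite -mulr_suml -/(gvol _ _ _ _) mulrCA divff ?mulr1 // gt_eqF.
Qed.

Lemma cover_ge a s : 0 < s -> CD^-1 <= \sum_(z in ball a s) pi z / vol z s.
Proof.
move=> s0; have va : 0 < vol a s by rewrite gvol_gt0 // ltW.
apply: (@le_trans _ _ (\sum_(z in ball a s) pi z * (CD * vol a s)^-1)).
  by rewrite -mulr_suml -/(gvol _ _ _ _) invfM mulrCA divff ?mulr1 // gt_eqF.
apply: ler_sum => z za; rewrite ler_pM2l ?(stationary_gt0 mk) //.
rewrite lef_pV2 ?posrE ?mulr_gt0 ?(doubling_gt0 a) ?gvol_gt0 ?(ltW s0) //.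
by apply: (@gvol_comparable1 _ _ _ _ s); rewrite //; lra.
Qed.

Lemma cover_double_le a s : 0 < s -> \sum_(z in ball a (2 * s)) pi z / vol z s <= CD ^+ 2.
Proof.
move=> s0; have CD0 := doubling_gt0 a.
have s20 : 0 < 2 * s by lra.
apply: (@le_trans _ _ (CD * \sum_(z in ball a (2 * s)) pi z / vol z (2 * s))); last first.
  by rewrite expr2 ler_pM2l // cover_le.
rewrite mulr_sumr; apply: ler_sum => z _.
rewrite mulrCA ler_pM2l ?(stationary_gt0 mk) // ler_pdivlMr ?gvol_gt0 ?(ltW s20) //.
by rewrite mulrC ler_pdivrMr ?gvol_gt0 ?(ltW s0) // vd.
Qed.

Lemma cover_half_ge a s :
  0 < s -> (CD ^+ 2)^-1 <= \sum_(z in ball a (s / 2)) pi z / vol z s.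
Proof.
move=> s0; have CD0 := doubling_gt0 a.
have s20 : 0 < s / 2 by lra.
apply: (@le_trans _ _ (CD^-1 * \sum_(z in ball a (s / 2)) pi z / vol z (s / 2))).
  by rewrite expr2 invfM ler_pM2l ?invr_gt0 // cover_ge.
rewrite mulr_sumr; apply: ler_sum => z _.
rewrite mulrCA ler_pM2l ?(stationary_gt0 mk) // -invfM.
rewrite lef_pV2 ?posrE ?mulr_gt0 ?gvol_gt0 ?(ltW s20) ?(ltW s0) //.
by have := @vd z (s / 2) s20; rewrite mulrC divfK // pnatr_eq0.
Qed.

End Volumes.

(** * Poincare inequalities *)

Section Poincare.

Variables (R : realType) (V : finType) (e : rel V).
Variables (K : V -> V -> R) (pi : V -> R).
Hypothesis mk : markov_kernel e K pi.
Variables (theta CP : R).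
Hypothesis CP0 : 0 < CP.
Hypothesis pinq : condPI e K pi theta CP.

Implicit Types (x y z u : V) (r s : R) (f : V -> R).

Local Notation ball := (gball e).
Local Notation vol := (gvol e pi).
Local Notation EE := (energy_on K pi).

Lemma poincare x r f : 0 < r -> exists m,
  \sum_(z in ball x r) (f z - m) ^+ 2 * pi z <= CP * r `^ theta * EE (ball x r) f.
Proof.
move=> r0; exists (ball_mean e pi x r f); have := @pinq x r r0 f.
under eq_bigr do rewrite real_normK ?num_real //.
move/le_trans; apply; rewrite ler_wpM2l ?mulr_ge0 ?powR_ge0 ?(ltW CP0) //.
apply: ler_sum => z _; rewrite big_mkcondr; apply: ler_sum => u _.
case: ifP => _; first by rewrite real_normK ?num_real // -mulrA [K z u * _]mulrC.
by rewrite mulr_ge0 ?sqr_ge0 ?(conductance_ge0 mk).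
Qed.

(** The mean of f lies on one side of (a+b)/2, hence at distance at least
    (b-a)/2 from the values of f on one of the two sets. *)
Lemma poincare_two_sets x r f (P Q : pred V) a b m :
  0 < r -> a <= b -> 0 <= m ->
  (forall z, z \in ball x r -> P z -> f z <= a) ->
  (forall z, z \in ball x r -> Q z -> b <= f z) ->
  m <= \sum_(z in ball x r | P z) pi z ->
  m <= \sum_(z in ball x r | Q z) pi z ->
  (b - a) ^+ 2 * m <= 4 * CP * r `^ theta * EE (ball x r) f.
Proof.
move=> r0 ab m0 fP fQ mP mQ; have [c hc] := poincare x f r0.
suff : (b - a) ^+ 2 / 4 * m <= \sum_(z in ball x r) (f z - c) ^+ 2 * pi z.
  by move=> /le_trans /(_ hc); lra.
have gen (P' : pred V) : (forall z, z \in ball x r -> P' z ->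
      (b - a) ^+ 2 / 4 <= (f z - c) ^+ 2) ->
    m <= \sum_(z in ball x r | P' z) pi z ->
    (b - a) ^+ 2 / 4 * m <= \sum_(z in ball x r) (f z - c) ^+ 2 * pi z.
  move=> h mP'; apply: (@le_trans _ _ ((b - a) ^+ 2 / 4 * \sum_(z in ball x r | P' z) pi z)).
    by rewrite ler_wpM2l // divr_ge0 ?sqr_ge0.
  rewrite mulr_sumr big_mkcondr; apply: ler_sum => z zB.
  case: ifP => [Pz|_]; first by rewrite ler_wpM2r ?h // ltW ?(stationary_gt0 mk).
  by rewrite mulr_ge0 ?sqr_ge0 // ltW ?(stationary_gt0 mk).
have [cm|cm] := leP c ((a + b) / 2).
  by apply: (gen Q) mQ => z zB Qz; have := fQ z zB Qz; nra.
by apply: (gen P) mP => z zB Pz; have := fP z zB Pz; nra.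
Qed.

(** If f vanishes on half of a ball, its mean is controlled by its oscillation,
    and the Poincare inequality bounds f itself. *)
Lemma poincare_half x r f :
  0 < r -> vol x r / 2 <= \sum_(z in ball x r | f z == 0) pi z ->
  \sum_(z in ball x r) f z ^+ 2 * pi z <= 6 * CP * r `^ theta * EE (ball x r) f.
Proof.
move=> r0 half; have [c hc] := poincare x f r0.
set X := \sum_(z in _) _ in hc.
suff : \sum_(z in ball x r) f z ^+ 2 * pi z <= 6 * X by lra.
have cX : c ^+ 2 * vol x r <= 2 * X.
  suff : c ^+ 2 * (vol x r / 2) <= X by lra.
  apply: (@le_trans _ _ (c ^+ 2 * \sum_(z in ball x r | f z == 0) pi z)).
    by rewrite ler_wpM2l ?sqr_ge0.
  rewrite mulr_sumr big_mkcondr; apply: ler_sum => z zB.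
  case: ifP => [/eqP ->|_]; first by rewrite sub0r sqrrN.
  by rewrite mulr_ge0 ?sqr_ge0 // ltW ?(stationary_gt0 mk).
suff : \sum_(z in ball x r) f z ^+ 2 * pi z <= 2 * X + 2 * (c ^+ 2 * vol x r) by lra.
rewrite /X /gvol !mulr_sumr -big_split; apply: ler_sum => z _ /=.
have := stationary_gt0 mk z; have : 0 <= (f z - c - c) ^+ 2 by apply: sqr_ge0.
nra.
Qed.

Variable CD : R.
Hypothesis vd : condVD e pi CD.

(** Local Faber-Krahn principle: a function whose support fills at most half
    of every ball of radius s satisfies a Poincare inequality at that scale,
    obtained by averaging over all these balls. *)
Lemma faber_krahn x r s f :
  0 < s ->
  (forall z, z \in ball x (r + s) ->
     \sum_(u in ball z s | f u != 0) pi u <= vol z s / 2) ->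
  \sum_(z in ball x r) f z ^+ 2 * pi z <=
  6 * CP * CD ^+ 2 * s `^ theta * EE (ball x (r + 2 * s)) f.
Proof.
move=> s0 small; have CD0 := doubling_gt0 mk vd x.
have v0 z : 0 < vol z s by rewrite (gvol_gt0 mk) // ltW.
pose p z := pi z / vol z s.
have p0 z : 0 <= p z by rewrite divr_ge0 ?ltW ?(stationary_gt0 mk).
have PI z : z \in ball x (r + s) -> \sum_(u in ball z s) f u ^+ 2 * pi u <=
    6 * CP * s `^ theta * EE (ball z s) f.
  move=> zB; apply: poincare_half => //.
  have : vol z s = \sum_(u in ball z s | f u == 0) pi u +
      \sum_(u in ball z s | f u != 0) pi u.
    by rewrite /gvol (bigID (fun u => f u == 0)).
  by have := small z zB; lra.
have upper : \sum_(z in ball x r) f z ^+ 2 * pi z <=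
    CD * \sum_(z in ball x (r + s)) p z * \sum_(u in ball z s) f u ^+ 2 * pi u.
  have -> : \sum_(z in ball x (r + s)) p z * \sum_(u in ball z s) f u ^+ 2 * pi u =
      \sum_u \sum_(z in ball x (r + s) | u \in ball z s) p z * (f u ^+ 2 * pi u).
    under eq_bigr do rewrite mulr_sumr.
    by rewrite (exchange_big_dep predT).
  rewrite mulr_sumr big_mkcond; apply: ler_sum => u _.
  have fu0 : 0 <= f u ^+ 2 * pi u by rewrite mulr_ge0 ?sqr_ge0 ?ltW ?(stationary_gt0 mk).
  rewrite -mulr_suml; case: ifPn => [uB|_]; last first.
    by apply: mulr_ge0 (ltW CD0) (mulr_ge0 _ fu0); apply: sumr_ge0.
  rewrite mulrA ler_peMl // -(mulfV (lt0r_neq0 CD0)) ler_pM2l //.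
  apply: le_trans (cover_ge mk vd u s0) _; rewrite le_eqVlt; apply/orP; left.
  apply/eqP; apply: eq_bigl => z; rewrite [u \in _](gball_sym mk).
  apply/idP/andP => [zu|[]//]; split=> //.
  exact: (gball_trans mk (lexx _) uB zu).
apply: (le_trans upper).
have -> : 6 * CP * CD ^+ 2 * s `^ theta * EE (ball x (r + 2 * s)) f =
  CD * (6 * CP * s `^ theta) * (CD * EE (ball x (r + 2 * s)) f) by ring.
rewrite -mulrA ler_pM2l //.
apply: (@le_trans _ _ ((6 * CP * s `^ theta) *
    \sum_(z in ball x (r + s)) p z * EE (ball z s) f)).
  rewrite mulr_sumr; apply: ler_sum => z zB; rewrite mulrCA ler_wpM2l //.
  exact: PI.
rewrite ler_wpM2l ?mulr_ge0 ?powR_ge0 ?(ltW CP0) //.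
have t0 a b : 0 <= (f a - f b) ^+ 2 * conductance K pi a b.
  by rewrite mulr_ge0 ?sqr_ge0 ?(conductance_ge0 mk).
have -> : \sum_(z in ball x (r + s)) p z * EE (ball z s) f =
  \sum_a \sum_b \sum_(z in ball x (r + s) | (a \in ball z s) && (b \in ball z s))
     p z * ((f a - f b) ^+ 2 * conductance K pi a b).
  under eq_bigr do rewrite mulr_sumr.
  rewrite (exchange_big_dep predT) //=; apply: eq_bigr => a _.
  under eq_bigr do rewrite mulr_sumr.
  rewrite (exchange_big_dep predT) //=; apply: eq_bigr => b _.
  by apply: eq_bigl => z; rewrite andbA.
rewrite /energy_on mulr_sumr [leRHS]big_mkcond; apply: ler_sum => a _.
case: ifPn => aB; last first.
  rewrite big1 // => b _; rewrite big_pred0 // => z; apply/negP.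
  move=> /and3P[zB az _]; case/negP: aB.
  by apply: (gball_trans mk _ zB az); lra.
rewrite mulr_sumr [leRHS]big_mkcond; apply: ler_sum => b _.
rewrite -mulr_suml; case: ifPn => bB; last first.
  rewrite big_pred0 ?mul0r // => z; apply/negP.
  move=> /and3P[zB _ bz]; case/negP: bB.
  by apply: (gball_trans mk _ zB bz); lra.
rewrite ler_wpM2r //; apply: le_trans (cover_le mk vd a s0).
rewrite [leLHS]big_mkcond [leRHS]big_mkcond; apply: ler_sum => z _.
rewrite [a \in _](gball_sym mk); case: ifPn => [/and3P[_ -> _]//|_].
by case: ifP => // _; apply: p0.
Qed.

End Poincare.

(** * Level sets of subsolutions *)

Lemma geometric_small (R : realType) (q c d : R) :
  0 <= q -> q < 1 -> 0 < d -> exists n, c * q ^+ n < d.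
Proof.
move=> q0 q1 d0; have q1' : `|q| < 1 by rewrite ger0_norm.
have : (fun n => c * q ^+ n) @ \oo --> c * 0 by apply: cvgMr; exact: cvg_expr.
rewrite mulr0 => /cvgrPdist_lt /(_ _ d0) [n _ /(_ n (leqnn n))] /=.
by rewrite sub0r normrN => /(le_lt_trans (ler_norm _)) h; exists n.
Qed.

Lemma le_of_geometric (R : realType) (q a b c : R) :
  0 <= q -> q < 1 -> (forall n, a <= c * q ^+ n + b) -> a <= b.
Proof.
move=> q0 q1 h; rewrite leNgt; apply/negP => ba.
have [|n hn] := @geometric_small R q c (a - b) q0 q1; first by rewrite subr_gt0.
by have := h n; lra.
Qed.

Section DeGiorgi.

Variables (R : realType) (V : finType) (e : rel V).
Variables (K : V -> V -> R) (pi : V -> R).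
Hypothesis mk : markov_kernel e K pi.

Implicit Types (x y z u : V) (r s t : R) (f g v : V -> R).

Local Notation ball := (gball e).
Local Notation vol := (gvol e pi).
Local Notation EE := (energy_on K pi).
Local Notation DD := (dirichlet K pi).

Lemma dirichlet_source g f y :
  (forall z, z != y -> g z <= 1 + markov_op K g z) ->
  (forall z, 0 <= f z) -> f y = 0 ->
  DD g f <= 2 * \sum_z f z * pi z.
Proof.
move=> gK f0 fy; rewrite (dirichletE mk) ler_pM2l //; apply: ler_sum => z _.
rewrite ler_wpM2r ?(mk_pi_ge0 mk) //.
have [->|zy] := eqVneq z y; first by rewrite fy mul0r.
by rewrite ler_piMr // lerBlDr gK.
Qed.

Lemma dirichlet_le f g h :
  (forall z u, (f z - f u) ^+ 2 <= (g z - g u) * (h z - h u)) ->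
  DD f f <= DD g h.
Proof.
move=> fg; do 2!apply: ler_sum => ? _.
by rewrite ler_wpM2r ?(conductance_ge0 mk) // -expr2.
Qed.

(** In terms of networks: at most a unit current flows through every level set
    of g, so a layer of thickness b-a dissipates at most of order b-a, whatever
    the geometry. *)
Lemma layer_energy g y a b :
  (forall z, z != y -> g z <= 1 + markov_op K g z) -> g y = 0 ->
  0 <= a -> a <= b ->
  DD (fun z => clip a b (g z)) (fun z => clip a b (g z)) <= 2 * (b - a).
Proof.
move=> gK gy a0 ab.
pose f z := clip a b (g z) - a.
apply: (@le_trans _ _ (DD g f)).
  apply: dirichlet_le => z u; rewrite /f opprB addrA subrK.
  exact: clip_contract.
apply: le_trans (dirichlet_source gK _ _) _.
- by move=> z; rewrite subr_ge0 clip_ge.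
- by rewrite /f gy clip_low // subrr.
rewrite ler_pM2l // -[leRHS]mulr1 -(mk_pi_sum1 mk) mulr_sumr.
apply: ler_sum => z _; rewrite ler_wpM2r ?(mk_pi_ge0 mk) //.
by rewrite lerB // clip_le.
Qed.

Lemma excess_energy g y t :
  (forall z, z != y -> g z <= 1 + markov_op K g z) -> g y = 0 -> 0 <= t ->
  DD (fun z => pos_part (g z - t)) (fun z => pos_part (g z - t)) <=
  2 * \sum_z pos_part (g z - t) * pi z.
Proof.
move=> gK gy t0; apply: le_trans (dirichlet_source gK _ _).
- apply: dirichlet_le => z u; apply: le_trans (pos_part_contract _ _) _.
  by rewrite opprB addrA subrK.
- by move=> z; apply: pos_part_ge0.
- by rewrite gy pos_part_eq0 // sub0r oppr_le0.
Qed.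

Variables (theta CP CD : R).
Hypothesis CP0 : 0 < CP.
Hypothesis pinq : condPI e K pi theta CP.
Hypothesis vd : condVD e pi CD.

(** De Giorgi iteration.  The j-th step looks at the part of v above the level
    k(1-q) in the ball of radius r(1+q), where q = 2^-j.  When q is halved, the
    new truncation lives on a set of small measure by Chebyshev, so that
    faber_krahn applies at the scale 2^-m r q; with the energy bound assumed of
    the truncations, the square mass contracts by the factor 1/(4 CD).  That
    rate is chosen to beat the two losses of a step: 4 in Chebyshev's
    inequality, because the gap of the levels is halved, and CD in volume,
    because the scale is halved. *)
Lemma de_giorgi x r v k C3 m :
  0 < r -> 0 < k -> (3 <= m)%N ->
  6 * CP * CD ^+ 2 * C3 * (2^-1 ^+ m) `^ theta <= (4 * CD)^-1 ->
  (forall j, let q : R := 2^-1 ^+ j in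
     EE (ball x (r * (1 + 3 / 4 * q))) (fun z => pos_part (v z - k * (1 - q / 2))) <=
     C3 * (r * q) `^ (- theta) *
       \sum_(z in ball x (r * (1 + q))) pos_part (v z - k * (1 - q)) ^+ 2 * pi z) ->
  8 * CD ^+ (m + 2) * \sum_(z in ball x (2 * r)) pos_part (v z) ^+ 2 * pi z <=
    k ^+ 2 * vol x (2 * r) ->
  v x <= k.
Proof.
move=> r0 k0 m3 hm hE hA; have CD0 := doubling_gt0 mk vd x.
have CD1 := doubling_ge1 mk vd x.
pose q j : R := 2^-1 ^+ j.
pose A j := \sum_(z in ball x (r * (1 + q j)))
  pos_part (v z - k * (1 - q j)) ^+ 2 * pi z.
have q0 j : 0 < q j by rewrite exprn_gt0.
have q1 j : q j <= 1 by rewrite exprn_ile1 //; lra.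
have qS j : q j.+1 = q j / 2 by rewrite /q exprS mulrC.
have A_ge0 j : 0 <= A j.
  by apply: sumr_ge0 => z _; rewrite mulr_ge0 ?sqr_ge0 // (mk_pi_ge0 mk).
pose eta : R := (4 * CD)^-1.
have eta0 : 0 < eta by rewrite invr_gt0; lra.
have A0E : A 0%N = \sum_(z in ball x (2 * r)) pos_part (v z) ^+ 2 * pi z.
  rewrite /A /q expr0 subrr mulr0 mulrC.
  by apply: eq_bigr => z _; rewrite subr0.
have kap : q m <= 1 / 8.
  rewrite -(subnK m3) /q exprD; have := q1 (m - 3)%N; rewrite /q => h.
  have -> : (2^-1 : R) ^+ 3 = 1 / 8 by rewrite !exprS expr0; field.
  by have := q0 (m - 3)%N; rewrite /q => ?; nra.
have decay j : A j <= A 0%N * eta ^+ j.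
  elim: j => [|j IH]; first by rewrite expr0 mulr1.
  pose s := q m * (r * q j).
  have s0 : 0 < s by rewrite !mulr_gt0.
  have rq0 : 0 < r * q j by rewrite mulr_gt0.
  have sle : s <= r * q j / 8 by rewrite /s; nra.
  pose w z := pos_part (v z - k * (1 - q j.+1)).
  have rad : r * (1 + q j.+1) + 2 * s <= r * (1 + 3 / 4 * q j) by rewrite qS; lra.
  have rad' : r * (1 + 3 / 4 * q j) <= r * (1 + q j) by lra.
  have rad2 : r * (1 + q j) <= 2 * r by have := q1 j; nra.
  have small z : z \in ball x (r * (1 + q j.+1) + s) ->
      \sum_(u in ball z s | w u != 0) pi u <= vol z s / 2.
    move=> zB; set M := \sum_(u in _ | _) _.
    have cheb : (k * (q j / 2)) ^+ 2 * M <= A j.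
      rewrite /M /A mulr_sumr [leRHS]big_mkcond [leLHS]big_mkcond.
      apply: ler_sum => u _; case: ifPn => [/andP[uz wu]|_]; last first.
        by case: ifP => // _; rewrite mulr_ge0 ?sqr_ge0 ?(mk_pi_ge0 mk).
      have -> : u \in ball x (r * (1 + q j)).
        by apply: (gball_trans mk _ zB uz); lra.
      rewrite ler_wpM2r ?(mk_pi_ge0 mk) //.
      rewrite ler_sqr ?nnegrE ?pos_part_ge0 ?mulr_ge0 ?divr_ge0 ?(ltW k0) ?(ltW (q0 j)) //.
      apply: le_trans (pos_part_ge _).
      have vu : 0 < v u - k * (1 - q j.+1).
        by rewrite ltNge; apply: contraNN wu => /pos_part_eq0; rewrite /w => ->.
      by rewrite qS in vu; lra.
    (* The scale s is 2^-(j+m+2) times 4r, and B(z,4r) contains B(x,2r). *)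
    have volxz : vol x (2 * r) <= CD ^+ (j + m + 2) * vol z s.
      apply: (gvol_comparable mk vd s0) => u xu.
      have -> : 2 ^+ (j + m + 2) * s = 4 * r.
        rewrite /s /q !exprD !exprVn; field.
        by rewrite !expf_neq0 ?pnatr_eq0.
      have xz : x \in ball z (2 * r).
        by rewrite (gball_sym mk); apply: gball_le zB; lra.
      by apply: (gball_trans mk _ xz xu); lra.
    have h8 : 8 * A 0%N <= k ^+ 2 * (CD ^+ j * vol z s).
      rewrite -(ler_pM2l (exprn_gt0 (m + 2) CD0)).
      have -> : CD ^+ (m + 2) * (8 * A 0%N) = 8 * CD ^+ (m + 2) * A 0%N by ring.
      rewrite A0E; apply: (le_trans hA).
      have -> : CD ^+ (m + 2) * (k ^+ 2 * (CD ^+ j * vol z s)) =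
        k ^+ 2 * (CD ^+ (j + m + 2) * vol z s) by rewrite !exprD; ring.
      by rewrite ler_pM2l // exprn_gt0.
    have etaj : eta ^+ j * CD ^+ j = q j ^+ 2.
      rewrite -exprMn /q exprAC; congr (_ ^+ j); rewrite /eta expr2; field.
      by rewrite lt0r_neq0.
    have h9 : 8 * (A 0%N * eta ^+ j) <= k ^+ 2 * (q j ^+ 2 * vol z s).
      have := ler_wpM2r (ltW (exprn_gt0 j eta0)) h8; rewrite -etaj; lra.
    have kq : 0 < (k * q j) ^+ 2 by rewrite exprn_gt0 // mulr_gt0.
    rewrite -(ler_pM2l kq) -subr_ge0; move: cheb IH h9; rewrite !exprMn; lra.
  have := faber_krahn mk CP0 pinq vd s0 small.
  rewrite -/(A j.+1) => FK.
  have {}FK : A j.+1 <= 6 * CP * CD ^+ 2 * s `^ theta *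
      (C3 * (r * q j) `^ (- theta) * A j).
    apply: (le_trans FK); rewrite ler_pM2l; last first.
      by rewrite !mulr_gt0 ?powR_gt0 // exprn_gt0.
    apply: (@le_trans _ _ (EE (ball x (r * (1 + 3 / 4 * q j))) w)).
      by apply: (energy_on_subset mk); apply: gball_le.
    by rewrite /w qS; exact: hE.
  have sq : s `^ theta * (r * q j) `^ (- theta) = q m `^ theta.
    rewrite /s powRM ?(ltW (q0 m)) ?(ltW rq0) // powRN mulfK //.
    by rewrite lt0r_neq0 // powR_gt0.
  apply: (le_trans FK).
  have -> : 6 * CP * CD ^+ 2 * s `^ theta * (C3 * (r * q j) `^ (- theta) * A j) =
     6 * CP * CD ^+ 2 * C3 * (s `^ theta * (r * q j) `^ (- theta)) * A j by ring.
  rewrite sq; apply: le_trans (ler_wpM2r (A_ge0 j) hm) _.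
  by rewrite exprS mulrCA ler_pM2l.
have final j : pi x * pos_part (v x - k) ^+ 2 <= A 0%N * eta ^+ j + 0.
  rewrite addr0; apply: le_trans (decay j).
  rewrite /A (bigD1 x) /=; last first.
    by apply: gball_center; rewrite mulr_ge0 ?(ltW r0) // addr_ge0 // ltW.
  rewrite -[leLHS]addr0 lerD //; last first.
    by apply: sumr_ge0 => z _; rewrite mulr_ge0 ?sqr_ge0 // (mk_pi_ge0 mk).
  rewrite mulrC ler_wpM2r ?(mk_pi_ge0 mk) // ler_sqr ?nnegrE ?pos_part_ge0 //.
  rewrite /pos_part ge_max !le_max lexx orbT andbT lerD2l lerN2.
  by have -> : k * (1 - q j) <= k by have := q0 j; nra.
have eta1 : eta < 1 by rewrite /eta invf_lt1; lra.
have := le_of_geometric (ltW eta0) eta1 final.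
rewrite pmulr_rle0 ?(stationary_gt0 mk) //.
rewrite leNgt => h; rewrite leNgt; apply: contraNN h => kv.
by rewrite exprn_gt0 // /pos_part lt_max subr_gt0 kv.
Qed.

End DeGiorgi.

(** * Cutoff functions and the Caccioppoli inequality *)

Section Cutoff.

Variables (R : realType) (V : finType) (e : rel V).
Variables (K : V -> V -> R) (pi : V -> R).
Hypothesis mk : markov_kernel e K pi.
Variables (theta C1' C2' eps : R).
Hypothesis theta0 : 0 < theta.
Hypothesis C20 : 0 < C2'.
Hypothesis cs : condCS e K pi theta C1' C2' eps.

Implicit Types (x y z u : V) (r s t : R) (f g v : V -> R).

Local Notation ball := (gball e).
Local Notation vol := (gvol e pi).
Local Notation EE := (energy_on K pi).
Local Notation DD := (dirichlet K pi).
Local Notation cc := (conductance K pi).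

Definition cutoff x s (sigma : V -> R) : Prop :=
  [/\ forall z, 0 <= sigma z <= 1,
      forall z, z \in ball x (s / 2) -> sigma z = 1 &
      forall z, z \notin ball x s -> sigma z = 0].

Lemma cutoff_diff_le1 x s sigma z u :
  cutoff x s sigma -> (sigma z - sigma u) ^+ 2 <= 1.
Proof. by case=> s01 _ _; have := s01 z; have := s01 u; nra. Qed.

(** The condition sums over the points z of the ball only.  On an edge that
    enters the ball from outside, f z is compared to f u; the difference is
    part of the energy in the double ball, because 1 <= s. *)
Lemma cutoff_exists x s : 1 <= s -> exists2 sigma, cutoff x s sigma &
  forall f, \sum_z \sum_u f z ^+ 2 * (sigma z - sigma u) ^+ 2 * cc z u <=
    (3 * C2' + 2) * (EE (ball x (2 * s)) f +
      s `^ (- theta) * \sum_(z in ball x (2 * s)) f z ^+ 2 * pi z).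
Proof.
move=> s1; have s0 : 0 < s by lra.
have [sg [sg1 sg0 _ sgE]] := cs x s0.
pose sigma z := clip 0 1 (sg z).
have cut : cutoff x s sigma.
  split=> z; first by rewrite clip_ge clip_le.
    by move=> /sg1; exact: clip_high.
  by move=> /sg0 sz; rewrite /sigma sz clip_low.
exists sigma => // f.
set G := EE _ _; set M := _ * \sum_(z in _) _.
have G0 : 0 <= G by apply: (energy_on_ge0 mk).
pose t z u := f z ^+ 2 * (sigma z - sigma u) ^+ 2 * cc z u.
have t0 z u : 0 <= t z u.
  exact: mulr_ge0 (mulr_ge0 (sqr_ge0 _) (sqr_ge0 _)) (conductance_ge0 mk _ _).
have inner : \sum_(z in ball x s) \sum_u t z u <= C2' * (G + M).
  have := sgE s s0 (lexx s) f; rewrite divff ?lt0r_neq0 // powR1 mulr1 => sgE'.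
  have {sgE'} sgE' : \sum_(z in ball x s) (`|f z| ^+ 2 * \sum_(y | e y z)
      `|sg z - sg y| ^+ 2 * K z y * pi z) <= C2' * (G + M).
    apply: (le_trans sgE'); rewrite ler_pM2l // lerD //; last first.
      by rewrite /M; under eq_bigr do rewrite real_normK ?num_real //.
    apply: ler_sum => z _; rewrite big_mkcondr; apply: ler_sum => u _.
    case: ifP => _.
      by rewrite real_normK ?num_real // -mulrA [K z u * _]mulrC.
    by rewrite mulr_ge0 ?sqr_ge0 ?(conductance_ge0 mk).
  apply: le_trans sgE'; apply: ler_sum => z _.
  rewrite mulr_sumr [leRHS]big_mkcond; apply: ler_sum => u _.
  have -> : `|sg z - sg u| ^+ 2 * K z u * pi z = (sg z - sg u) ^+ 2 * cc z u.
    by rewrite real_normK ?num_real // /conductance; ring.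
  rewrite real_normK ?num_real // /t -[leLHS]mulrA.
  have [->|c0] := eqVneq (cc z u) 0; first by rewrite !mulr0 if_same.
  rewrite (mk_edge_sym mk); case: ifPn => ezu; last first.
    have [->|zu] := eqVneq z u; first by rewrite subrr expr0n /= mul0r mulr0.
    by case/eqP: c0; rewrite /conductance (mk_nonedge_eq0 mk) // mulr0.
  rewrite ler_wpM2l ?sqr_ge0 //.
  by rewrite ler_wpM2r ?(conductance_ge0 mk) ?clip_lip.
pose bd z u := if (z \notin ball x s) && (u \in ball x s) then t z u else 0.
have outer : \sum_(z | z \notin ball x s) \sum_u t z u <= \sum_z \sum_u bd z u.
  rewrite big_mkcond; apply: ler_sum => z _; rewrite /bd.
  case: ifPn => zB; last by rewrite big1.
  apply: ler_sum => u _; case: ifPn => // uB.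
  rewrite /t; case: cut => _ _ cut0.
  by rewrite !cut0 // subrr expr0n /= mulr0 mul0r.
have bdle : \sum_z \sum_u bd z u <= 2 * (C2' * (G + M)) + 2 * G.
  have bd2 z u : bd z u <= 2 * (if u \in ball x s then t u z else 0) +
      2 * (if z \in ball x (2 * s) then
             if u \in ball x (2 * s) then (f z - f u) ^+ 2 * cc z u else 0 else 0).
    rewrite /bd; have h0 : 0 <= (f z - f u) ^+ 2 * cc z u.
      by rewrite mulr_ge0 ?sqr_ge0 ?(conductance_ge0 mk).
    case: (boolP (u \in ball x s)) => uB; last first.
      by rewrite andbF mulr0 add0r mulr_ge0 //; do 2?case: ifP.
    rewrite andbT; have [c0|c0] := eqVneq (cc u z) 0.
      rewrite /t (conductance_sym mk z u) c0 !mulr0 add0r.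
      by rewrite !if_same mulr0.
    have -> : u \in ball x (2 * s) by apply: gball_le uB; lra.
    have -> : z \in ball x (2 * s).
      by apply: gball_le (gball_neighbour mk uB c0); lra.
    case: ifPn => _; last by rewrite addr_ge0 // mulr_ge0.
    have -> : 2 * t u z + 2 * ((f z - f u) ^+ 2 * cc z u) =
        (2 * (f u ^+ 2 * (sigma z - sigma u) ^+ 2) + 2 * (f z - f u) ^+ 2) * cc z u.
      by rewrite /t (conductance_sym mk u z); ring.
    rewrite /t ler_wpM2r ?(conductance_ge0 mk) //.
    have := cutoff_diff_le1 z u cut.
    set d := (sigma z - sigma u) ^+ 2 => d1.
    have d0 : 0 <= d by apply: sqr_ge0.
    have fz : f z ^+ 2 <= 2 * f u ^+ 2 + 2 * (f z - f u) ^+ 2.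
      by have := sqr_ge0 (f z - f u - f u); nra.
    apply: le_trans (ler_wpM2r d0 fz) _; have := sqr_ge0 (f z - f u); nra.
  apply: (@le_trans _ _ (\sum_z \sum_u (2 * (if u \in ball x s then t u z else 0) +
      2 * (if z \in ball x (2 * s) then
             if u \in ball x (2 * s) then (f z - f u) ^+ 2 * cc z u else 0 else 0)))).
    by do 2!apply: ler_sum => ? _; apply: bd2.
  under eq_bigr do rewrite big_split /= -!mulr_sumr.
  rewrite big_split /= -!mulr_sumr lerD //; last first.
    rewrite ler_pM2l // /G /energy_on [leRHS]big_mkcond; apply: ler_sum => z _.
    by case: ifPn => zB; [rewrite [leRHS]big_mkcond | rewrite big1].
  rewrite ler_pM2l //; apply: le_trans inner; rewrite exchange_big [leRHS]big_mkcond.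
  by apply: ler_sum => z _ /=; case: ifPn => zB //; rewrite big1.
have M0 : 0 <= M.
  rewrite mulr_ge0 ?powR_ge0 // sumr_ge0 // => z _.
  by rewrite mulr_ge0 ?sqr_ge0 ?(mk_pi_ge0 mk).
rewrite (bigID (fun z => z \in ball x s)) /=.
move: inner outer bdle; rewrite /t; nra.
Qed.

(** A capacity estimate: the cutoff inequality with f = 1.  A ball of radius
    less than 1 is a point, and its indicator is the cutoff. *)
Lemma cutoff_energy x s : 0 < s -> exists2 sigma, cutoff x s sigma &
  DD sigma sigma <= (3 * C2' + 2) * (s `^ (- theta) * vol x (2 * s)).
Proof.
move=> s0; have [s1|s1] := leP 1 s.
  have [sg cut hsg] := cutoff_exists x s1; exists sg => //.
  have E0 : EE (ball x (2 * s)) (fun=> 1) = 0.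
    by rewrite /energy_on big1 // => z _; rewrite big1 // => u _; rewrite subrr expr0n mul0r.
  have := hsg (fun=> 1); rewrite E0 add0r.
  under [X in _ * (_ * X)]eq_bigr do rewrite expr1n mul1r.
  apply: le_trans; do 2!apply: ler_sum => ? _.
  by rewrite expr1n mul1r expr2.
exists (fun z => (z == x)%:R).
  split=> z; first by case: (z == x); rewrite ?lexx ler01.
    by move=> zx; rewrite (gball_small mk _ zx) ?eqxx //; lra.
  by apply: contraNeq; rewrite pnatr_eq0 eqb0 negbK => /eqP ->;
    rewrite gball_center // ltW.
have piV : pi x <= s `^ (- theta) * vol x (2 * s).
  apply: (@le_trans _ _ (vol x (2 * s))).
    rewrite -(@gvol_small _ _ _ _ _ mk x 0) //; apply: (gvol_mono mk); lra.
  rewrite ler_peMl ?(ltW (gvol_gt0 mk _ _)) //; first by rewrite mulr_ge0 // ltW.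
  rewrite powRN invf_ge1 ?powR_gt0 //.
  have : s `^ theta <= 1 `^ theta by apply: ge0_ler_powR; rewrite ?nnegrE ?ltW.
  by rewrite powR1.
apply: (@le_trans _ _ (2 * pi x)); last first.
  have W0 := le_trans (mk_pi_ge0 mk x) piV.
  by have := mulr_ge0 (ltW C20) W0; lra.
apply: (@le_trans _ _ (\sum_z \sum_u ((z == x)%:R * cc z u + (u == x)%:R * cc z u))).
  do 2!apply: ler_sum => ? _; rewrite -mulrDl ler_wpM2r ?(conductance_ge0 mk) //.
  by do 2!case: (_ == x); rewrite /=; lra.
under eq_bigr do rewrite big_split /=; rewrite big_split /=.
rewrite [X in _ + X]exchange_big /= -big_split /=.
rewrite (eq_bigr (fun z => (z == x)%:R * (2 * pi z))) => [|z _].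
  rewrite (bigD1 x) //= big1 ?eqxx ?addr0 ?mul1r // => z /negPf ->.
  by rewrite mul0r.
by rewrite -mulr_sumr (conductance_sum mk) -mulr_sumr (conductance_sumr mk); ring.
Qed.

Variable CD : R.
Hypothesis vd : condVD e pi CD.

Definition annulus_const : R := 2 * CD ^+ 7 * (3 * C2' + 2).

Lemma energy_onE A f : EE A f =
  \sum_a \sum_b (if (a \in A) && (b \in A) then (f a - f b) ^+ 2 * cc a b else 0).
Proof.
rewrite /energy_on big_mkcond; apply: eq_bigr => a _.
by case: ifP => _ /=; [rewrite big_mkcond | rewrite big1].
Qed.

(** Averaging the cutoffs of the balls B(z,s), z in B(x,r+s), gives a cutoff
    that varies only in a thin annulus.  The right-hand side then sees the
    energy of f in the annulus alone, although the cutoff inequality of a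
    single ball also sees the energy where the cutoff is constant. *)
Lemma annular_cutoff x r s : 1 <= s -> 0 <= r -> exists phi : V -> R,
  [/\ forall z, z \in ball x r -> phi z = 1,
      forall z, z \notin ball x (r + 2 * s) -> phi z = 0 &
  forall f, \sum_a \sum_b f a ^+ 2 * (phi a - phi b) ^+ 2 * cc a b <=
    annulus_const * (EE (ball x (r + 3 * s)) f - EE (ball x (r - 4 * s)) f +
      s `^ (- theta) * \sum_(z in ball x (r + 3 * s)) f z ^+ 2 * pi z)].
Proof.
move=> s1 r0; have s0 : 0 < s by lra.
have CD0 := doubling_gt0 mk vd x; have CD1 := doubling_ge1 mk vd x.
have hcut z : exists sg, cutoff z s sg /\
  forall f, \sum_a \sum_b f a ^+ 2 * (sg a - sg b) ^+ 2 * cc a b <=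
    (3 * C2' + 2) * (EE (ball z (2 * s)) f +
      s `^ (- theta) * \sum_(u in ball z (2 * s)) f u ^+ 2 * pi u).
  by have [sg ? ?] := cutoff_exists z s1; exists sg.
have {hcut} [sg hsg] := choice hcut.
have sgc z := (hsg z).1.
pose p z := pi z / vol z s.
have p0 z : 0 <= p z by rewrite divr_ge0 ?(mk_pi_ge0 mk) ?ltW ?(gvol_gt0 mk) ?ltW.
pose Phi u := \sum_(z in ball x (r + s)) p z * sg z u.
pose phi u := clip 0 1 (CD ^+ 2 * Phi u).
have phi1 u : u \in ball x r -> phi u = 1.
  move=> uB; apply: clip_high => //.
  rewrite -[leLHS](mulfV (lt0r_neq0 (exprn_gt0 2 CD0))) ler_pM2l ?exprn_gt0 //.
  apply: le_trans (cover_half_ge mk vd u s0) _.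
  rewrite /Phi [leLHS]big_mkcond [leRHS]big_mkcond; apply: ler_sum => z _.
  case: ifPn => [zu|_]; last first.
    by case: ifP => // _; rewrite mulr_ge0 //; case: (sgc z) => /(_ u) /andP[].
  have -> : z \in ball x (r + s) by apply: (gball_trans mk _ uB zu); lra.
  by case: (sgc z) => _ -> //; rewrite ?mulr1 // (gball_sym mk).
have phi0 u : u \notin ball x (r + 2 * s) -> phi u = 0.
  move=> uB; rewrite /phi /Phi big1 ?mulr0 ?clip_low // => z zB.
  case: (sgc z) => _ _ -> //; rewrite ?mulr0 //.
  by apply: contraNN uB => uz; apply: (gball_trans mk _ zB uz); lra.
exists phi; split=> // f.
(* An edge on which phi varies is not contained in B(x,r); the balls B(z,s)
   that meet it have their centres outside B(x,r-2s), as 1 <= s. *)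
pose Z z := (z \in ball x (r + s)) && (z \notin ball x (r - 2 * s)).
have key a b : (phi a - phi b) ^+ 2 * cc a b <=
    2 * CD ^+ 5 * \sum_(z | Z z) p z * ((sg z a - sg z b) ^+ 2 * cc a b).
  have S0 : 0 <= \sum_(z | Z z) p z * ((sg z a - sg z b) ^+ 2 * cc a b).
    apply: sumr_ge0 => z _.
    exact: mulr_ge0 (p0 z) (mulr_ge0 (sqr_ge0 _) (conductance_ge0 mk _ _)).
  have {}S0 := mulr_ge0 (mulr_ge0 (ler0n R 2) (exprn_ge0 5 (ltW CD0))) S0.
  have [c0|c0] := eqVneq (cc a b) 0.
    by apply: le_trans S0; rewrite c0 mulr0.
  have [/andP[aB bB]|nab] := boolP ((a \in ball x r) && (b \in ball x r)).
    by apply: le_trans S0; rewrite !phi1 // subrr expr0n /= mul0r.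
  pose n z := (a \in ball z s) || (b \in ball z s).
  have dsg z : ~~ n z -> sg z a - sg z b = 0.
    by rewrite negb_or => /andP[az bz]; case: (sgc z) => _ _ h; rewrite !h ?subrr.
  pose w z := if Z z && n z then p z else 0.
  have w0 z : 0 <= w z by rewrite /w; case: ifP.
  have dPhi : Phi a - Phi b = \sum_z 1 * (sg z a - sg z b) * w z.
    rewrite /Phi -sumrB big_mkcond; apply: eq_bigr => z _.
    rewrite mul1r /w /Z -mulrBr mulrC.
    have [nz|nz] := boolP (n z); last by rewrite dsg // !mul0r if_same.
    rewrite andbT; case: ifPn => zB //=; last by rewrite mulr0.
    case: ifPn => //; rewrite negbK => zB'; case/negP: nab.
    have c0' : cc b a != 0 by rewrite (conductance_sym mk).
    case/orP: nz => h; have hs := gball_trans mk (t := r - s) _ zB' h.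
      have aB : a \in ball x (r - s) by apply: hs; lra.
      apply/andP; split; first by apply: gball_le aB; lra.
      by apply: gball_le (gball_neighbour mk aB c0); lra.
    have bB : b \in ball x (r - s) by apply: hs; lra.
    apply/andP; split; last by apply: gball_le bB; lra.
    by apply: gball_le (gball_neighbour mk bB c0'); lra.
  have wsum : \sum_z w z <= 2 * CD.
    have cov c : \sum_(z | c \in ball z s) p z <= CD.
      apply: le_trans (cover_le mk vd c s0); rewrite le_eqVlt; apply/orP; left.
      by apply/eqP/eq_bigl => z; rewrite (gball_sym mk).
    have -> : 2 * CD = CD + CD by ring.
    apply: le_trans (lerD (cov a) (cov b)).
    rewrite [X in _ <= X + _]big_mkcond [X in _ <= _ + X]big_mkcond -big_split /=.
    apply: ler_sum => z _; rewrite /w /n; have := p0 z.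
    by case: (Z z); case: (a \in _); case: (b \in _) => /= ?; lra.
  (* Only the balls that contain a or b matter, and their total weight is
     bounded; so the square of the average is at most the average square. *)
  have := sum_cauchy_schwarz (fun=> 1) (fun z => sg z a - sg z b) w0.
  rewrite -dPhi; under [X in X * _]eq_bigr do rewrite expr1n mul1r.
  set S := (X in _ * X) => csq.
  have S1 : 0 <= S by apply: sumr_ge0 => z _; rewrite mulr_ge0 ?sqr_ge0.
  have {csq} csq : (Phi a - Phi b) ^+ 2 <= 2 * CD * S.
    by apply: (le_trans csq); rewrite ler_wpM2r.
  have hS : S * cc a b <= \sum_(z | Z z) p z * ((sg z a - sg z b) ^+ 2 * cc a b).
    rewrite /S mulr_suml [leRHS]big_mkcond; apply: ler_sum => z _; rewrite /w.
    have h0 : 0 <= p z * ((sg z a - sg z b) ^+ 2 * cc a b).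
      exact: mulr_ge0 (p0 z) (mulr_ge0 (sqr_ge0 _) (conductance_ge0 mk _ _)).
    case: (Z z) => /=; last by rewrite mulr0 mul0r.
    by case: ifP => _; [rewrite -mulrA mulrCA | rewrite mulr0 mul0r].
  apply: (@le_trans _ _ (2 * CD ^+ 5 * (S * cc a b))); last first.
    by rewrite ler_wpM2l // mulr_ge0 ?exprn_ge0 ?(ltW CD0).
  rewrite mulrA ler_wpM2r ?(conductance_ge0 mk) //.
  apply: le_trans (clip_lip _ _ _ _) _.
  have -> : (CD ^+ 2 * Phi a - CD ^+ 2 * Phi b) ^+ 2 = CD ^+ 4 * (Phi a - Phi b) ^+ 2.
    by ring.
  have -> : 2 * CD ^+ 5 * S = CD ^+ 4 * (2 * CD * S) by ring.
  by rewrite ler_pM2l // exprn_gt0.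
set G := EE (ball x (r + 3 * s)) f - _; set M := _ * \sum_(z in _) _.
have step1 : \sum_a \sum_b f a ^+ 2 * (phi a - phi b) ^+ 2 * cc a b <=
   2 * CD ^+ 5 * \sum_(z | Z z) p z *
     (\sum_a \sum_b f a ^+ 2 * (sg z a - sg z b) ^+ 2 * cc a b).
  have -> : \sum_(z | Z z) p z *
       (\sum_a \sum_b f a ^+ 2 * (sg z a - sg z b) ^+ 2 * cc a b) =
    \sum_a \sum_b f a ^+ 2 * \sum_(z | Z z) p z * ((sg z a - sg z b) ^+ 2 * cc a b).
    under eq_bigr do rewrite mulr_sumr.
    rewrite exchange_big; apply: eq_bigr => a _ /=.
    under eq_bigr do rewrite mulr_sumr.
    rewrite exchange_big; apply: eq_bigr => b _ /=.
    by rewrite mulr_sumr; apply: eq_bigr => z _; ring.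
  rewrite mulr_sumr; apply: ler_sum => a _; rewrite mulr_sumr; apply: ler_sum => b _.
  by rewrite -[leLHS]mulrA [leRHS]mulrCA ler_wpM2l ?sqr_ge0.
have stepG : \sum_(z | Z z) p z * EE (ball z (2 * s)) f <= CD ^+ 2 * G.
  rewrite /G mulrBr lerBrDr.
  have -> : \sum_(z | Z z) p z * EE (ball z (2 * s)) f =
    \sum_a \sum_b \sum_(z | Z z) p z * (if (a \in ball z (2 * s)) &&
       (b \in ball z (2 * s)) then (f a - f b) ^+ 2 * cc a b else 0).
    under eq_bigr do rewrite energy_onE mulr_sumr.
    rewrite exchange_big; apply: eq_bigr => a _ /=.
    by under eq_bigr do rewrite mulr_sumr; rewrite exchange_big.
  rewrite !energy_onE !mulr_sumr -big_split; apply: ler_sum => a _ /=.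
  rewrite !mulr_sumr -big_split; apply: ler_sum => b _ /=.
  set t := (f a - f b) ^+ 2 * _.
  have t0 : 0 <= t by rewrite mulr_ge0 ?sqr_ge0 ?(conductance_ge0 mk).
  have [/andP[aB bB]|nab] := boolP ((a \in ball x (r - 4 * s)) && (b \in ball x (r - 4 * s))).
    have -> : a \in ball x (r + 3 * s) by apply: gball_le aB; lra.
    have -> : b \in ball x (r + 3 * s) by apply: gball_le bB; lra.
    rewrite big1 ?add0r // => z /andP[_ zB]; case: ifPn; rewrite ?mulr0 //.
    rewrite (gball_sym mk) => /andP[za _]; case/negP: zB.
    by apply: (gball_trans mk _ aB za); lra.
  rewrite mulr0 addr0.
  have [/andP[aB bB]|nab'] := boolP ((a \in ball x (r + 3 * s)) && (b \in ball x (r + 3 * s))).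
    apply: (@le_trans _ _ ((\sum_(z in ball a (2 * s)) p z) * t)); last first.
      by rewrite ler_wpM2r // (cover_double_le mk vd).
    rewrite mulr_suml [leLHS]big_mkcond [leRHS]big_mkcond; apply: ler_sum => z _.
    rewrite (gball_sym mk a z); case: (a \in _) => /=; last by rewrite mulr0 if_same.
    have pt0 : 0 <= p z * t by rewrite mulr_ge0.
    by case: ifP => // _; case: ifP; rewrite ?mulr0.
  rewrite mulr0 big1 // => z /andP[zB _]; case: ifPn; rewrite ?mulr0 //.
  move=> /andP[az bz]; case/negP: nab'; apply/andP; split.
    by apply: (gball_trans mk _ zB az); lra.
  by apply: (gball_trans mk _ zB bz); lra.
have stepM : \sum_(z | Z z) p z * (\sum_(u in ball z (2 * s)) f u ^+ 2 * pi u) <=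
    CD ^+ 2 * \sum_(z in ball x (r + 3 * s)) f z ^+ 2 * pi z.
  under eq_bigr do rewrite mulr_sumr.
  rewrite (exchange_big_dep predT) //= mulr_sumr [leRHS]big_mkcond.
  apply: ler_sum => u _; rewrite -mulr_suml.
  have fu0 : 0 <= f u ^+ 2 * pi u by rewrite mulr_ge0 ?sqr_ge0 ?(mk_pi_ge0 mk).
  case: ifPn => uB; last first.
    rewrite big_pred0 ?mul0r // => z; apply/negP => /andP[/andP[zB _] uz].
    by case/negP: uB; apply: (gball_trans mk _ zB uz); lra.
  rewrite ler_wpM2r //; apply: le_trans (cover_double_le mk vd u s0).
  rewrite [leLHS]big_mkcond [leRHS]big_mkcond; apply: ler_sum => z _.
  rewrite (gball_sym mk u z); case: (u \in _); rewrite ?andbF //.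
  by case: ifP => // _; apply: p0.
apply: (le_trans step1).
have -> : annulus_const * (G + M) =
    2 * CD ^+ 5 * ((3 * C2' + 2) * (CD ^+ 2 * (G + M))) by rewrite /annulus_const; ring.
rewrite ler_pM2l ?mulr_gt0 ?exprn_gt0 //.
apply: (@le_trans _ _ ((3 * C2' + 2) * \sum_(z | Z z) p z * (EE (ball z (2 * s)) f +
      s `^ (- theta) * \sum_(u in ball z (2 * s)) f u ^+ 2 * pi u))).
  rewrite mulr_sumr; apply: ler_sum => z _; rewrite mulrCA ler_wpM2l //.
  exact: (hsg z).2.
rewrite ler_pM2l; last by rewrite addr_gt0 // mulr_gt0.
under eq_bigr do rewrite mulrDr.
rewrite big_split mulrDr lerD //= /M mulrCA.
under eq_bigr do rewrite mulrCA.
by rewrite -mulr_sumr ler_wpM2l ?powR_ge0.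
Qed.

End Cutoff.

(** The sum of a geometric series: with tau = ((1+kappa)/2)^(1/theta), a step
    that shrinks the remaining width by tau loses the factor
    kappa tau^-theta = 2 kappa/(1+kappa) < 1. *)
Definition hole_filling_const (R : realType) (theta kappa : R) : R :=
  (1 - ((1 + kappa) / 2) `^ theta^-1) `^ (- theta) / (1 - 2 * kappa / (1 + kappa)).

Lemma root_lt1 (R : realType) (theta a : R) :
  0 < theta -> 0 < a -> a < 1 -> a `^ theta^-1 < 1.
Proof.
move=> th0 a0 a1; rewrite ltNge; apply/negP => tau1.
have : 1 `^ theta <= (a `^ theta^-1) `^ theta.
  by apply: ge0_ler_powR; rewrite ?nnegrE ?(ltW th0) ?powR_ge0.
by rewrite powR1 -powRrM mulVf ?lt0r_neq0 // powRr1 ?(ltW a0) //; lra.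
Qed.

Lemma hole_filling_const_gt0 (R : realType) (theta kappa : R) :
  0 < theta -> 0 < kappa -> kappa < 1 -> 0 < hole_filling_const theta kappa.
Proof.
move=> th0 k0 k1; rewrite divr_gt0 ?powR_gt0 // subr_gt0.
  by apply: root_lt1 => //; lra.
by rewrite ltr_pdivrMr; lra.
Qed.

(** The hypothesis is iterated along radii that approach b geometrically,
    passing from t to t + (1-tau)(b-t). *)
Lemma hole_filling (R : realType) (theta kappa : R) (Z : R -> R) (a b X M : R) :
  0 < theta -> 0 < kappa -> kappa < 1 -> a < b -> 0 <= X ->
  (forall t, a <= t -> t < b -> Z t <= M) ->
  (forall t t', a <= t -> t < t' -> t' < b ->
     Z t <= kappa * Z t' + X * (t' - t) `^ (- theta)) ->
  Z a <= hole_filling_const theta kappa * X * (b - a) `^ (- theta).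
Proof.
move=> th0 k0 k1 ab X0 ZM Zh.
rewrite /hole_filling_const; set tau := _ `^ theta^-1; set mu := 2 * kappa / _.
have h12 : 0 < (1 + kappa) / 2 by lra.
have tau0 : 0 < tau by rewrite powR_gt0.
have tauE : tau `^ theta = (1 + kappa) / 2.
  by rewrite -powRrM mulVf ?lt0r_neq0 // powRr1 ?ltW.
have tau1 : tau < 1 by apply: root_lt1 => //; lra.
have mu0 : 0 < mu by rewrite divr_gt0 ?mulr_gt0 //; lra.
have mu1 : mu < 1 by rewrite /mu ltr_pdivrMr; lra.
have muE : kappa * tau `^ (- theta) = mu.
  by rewrite powRN tauE /mu; field; rewrite lt0r_neq0 //; lra.
set C := _ / (1 - mu).
have CE : (1 - tau) `^ (- theta) + mu * C = C.
  by rewrite /C; field; rewrite lt0r_neq0 //; lra.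
have C0 : 0 <= C by rewrite divr_ge0 ?powR_ge0 //; lra.
have claim n : forall t, a <= t -> t < b ->
    Z t <= M * kappa ^+ n + C * X * (b - t) `^ (- theta).
  elim: n => [|n IH] t ta tb.
    rewrite expr0 mulr1; apply: le_trans (ZM t ta tb) _; rewrite lerDl.
    exact: mulr_ge0 (mulr_ge0 C0 X0) (powR_ge0 _ _).
  pose t' := t + (1 - tau) * (b - t).
  have tt' : t < t' by rewrite /t' ltrDl mulr_gt0 ?subr_gt0.
  have t'b : t' < b.
    have : 0 < tau * (b - t) by rewrite mulr_gt0 ?subr_gt0.
    by rewrite /t'; lra.
  have bt' : b - t' = tau * (b - t) by rewrite /t'; ring.
  have t't : t' - t = (1 - tau) * (b - t) by rewrite /t'; ring.
  have at' : a <= t' by lra.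
  apply: le_trans (Zh t t' ta tt' t'b) _.
  have := IH t' at' t'b; rewrite bt' t't.
  rewrite !powRM ?subr_ge0 ?(ltW tb) ?(ltW tau1) ?(ltW tau0) //.
  set P := (b - t) `^ _ => IHt.
  have := ler_wpM2l (ltW k0) IHt; rewrite exprS.
  have E : kappa * (C * X * (tau `^ (- theta) * P)) = mu * C * X * P by rewrite -muE; ring.
  have := congr1 (fun c => c * X * P) CE; move: E; rewrite -/C; lra.
apply: (@le_of_geometric R kappa _ _ M) => [||n]; rewrite ?(ltW k0) //.
exact: claim.
Qed.

Section Caccioppoli.

Variables (R : realType) (V : finType) (e : rel V).
Variables (K : V -> V -> R) (pi : V -> R).
Hypothesis mk : markov_kernel e K pi.
Variables (theta C1' C2' eps CD : R).
Hypothesis theta0 : 0 < theta.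
Hypothesis C20 : 0 < C2'.
Hypothesis cs : condCS e K pi theta C1' C2' eps.
Hypothesis vd : condVD e pi CD.

Implicit Types (x y z u : V) (r s t : R) (f g v : V -> R).

Local Notation ball := (gball e).
Local Notation EE := (energy_on K pi).
Local Notation DD := (dirichlet K pi).
Local Notation cc := (conductance K pi).

(** The test function is phi^2 f.  Pointwise,
    (a-b)(p^2 a - q^2 b) = (pa - qb)^2 - ab(p-q)^2,
    and ab is at most (a^2+b^2)/2. *)
Lemma subsolution_cutoff f phi x r :
  (forall z, 0 <= f z) ->
  (forall z, z \in ball x r -> f z <= markov_op K f z) ->
  (forall z, z \notin ball x r -> phi z = 0) ->
  DD (fun z => phi z * f z) (fun z => phi z * f z) <=
  \sum_z \sum_u f z ^+ 2 * (phi z - phi u) ^+ 2 * cc z u.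
Proof.
move=> f0 fK phi0.
have : DD f (fun z => phi z ^+ 2 * f z) <= 0.
  rewrite (dirichletE mk) pmulr_rle0 //; apply: sumr_le0 => z _.
  have [/fK fz|/phi0 ->] := boolP (z \in ball x r); last first.
    by rewrite expr0n /= !mul0r.
  have := mulr_ge0 (mulr_ge0 (sqr_ge0 (phi z)) (f0 z)) (mk_pi_ge0 mk z).
  set w := phi z ^+ 2 * f z; set p := pi z => wp.
  have -> : w * (f z - markov_op K f z) * p = - (w * p * (markov_op K f z - f z)) by ring.
  by rewrite oppr_le0 mulr_ge0 // subr_ge0.
pose T := \sum_z \sum_u f z ^+ 2 * (phi z - phi u) ^+ 2 * cc z u.
have TE : T = \sum_z \sum_u f u ^+ 2 * (phi z - phi u) ^+ 2 * cc z u.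
  rewrite /T exchange_big; do 2!apply: eq_bigr => ? _ /=.
  by rewrite (conductance_sym mk); ring.
move=> D0; rewrite -/T.
suff : 2 * DD (fun z => phi z * f z) (fun z => phi z * f z) <=
    2 * DD f (fun z => phi z ^+ 2 * f z) + (T + T) by lra.
rewrite {2}TE /T /dirichlet !mulr_sumr -!big_split; apply: ler_sum => z _ /=.
rewrite !mulr_sumr -!big_split; apply: ler_sum => u _ /=.
rewrite -subr_ge0.
set lhs := (X in 0 <= X).
have -> : lhs = ((f z - f u) ^+ 2 * (phi z - phi u) ^+ 2) * cc z u by rewrite /lhs; ring.
by rewrite mulr_ge0 ?(conductance_ge0 mk) // mulr_ge0 ?sqr_ge0.
Qed.

Lemma energy_on_trivial A f : EE A f <= 4 * \sum_(z in A) f z ^+ 2 * pi z.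
Proof.
pose w z := if z \in A then f z else 0.
apply: (@le_trans _ _ (\sum_z \sum_u (2 * (w z ^+ 2 * cc z u) + 2 * (w u ^+ 2 * cc z u)))).
  rewrite energy_onE; apply: ler_sum => z _; apply: ler_sum => u _; rewrite /w.
  case: ifPn => [/andP[-> ->]|_]; last first.
    by rewrite addr_ge0 // mulr_ge0 // mulr_ge0 ?sqr_ge0 ?(conductance_ge0 mk).
  have -> : 2 * (f z ^+ 2 * cc z u) + 2 * (f u ^+ 2 * cc z u) =
      (2 * f z ^+ 2 + 2 * f u ^+ 2) * cc z u by ring.
  by rewrite ler_wpM2r ?(conductance_ge0 mk) //; have := sqr_ge0 (f z + f u); nra.
under eq_bigr do rewrite big_split; rewrite big_split /=.
rewrite [X in _ + X]exchange_big /= -big_split /=.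
rewrite mulr_sumr [leRHS]big_mkcond; apply: ler_sum => z _ /=.
rewrite -mulr_sumr -mulr_sumr (conductance_sum mk).
rewrite -[X in _ + X]mulr_sumr -[X in _ + 2 * X]mulr_sumr (conductance_sumr mk).
rewrite /w; case: ifP => _; first by lra.
by rewrite expr0n /= !mul0r mulr0 addr0.
Qed.

Definition caccioppoli_const : R :=
  hole_filling_const theta (annulus_const C2' CD / (1 + annulus_const C2' CD)) *
  (4 * 7 `^ theta).

Lemma caccioppoli_const_gt0 : 0 < CD -> 0 < caccioppoli_const.
Proof.
move=> CD0; apply: mulr_gt0; last by rewrite mulr_gt0 ?powR_gt0.
have A0 : 0 < annulus_const C2' CD.
  by rewrite /annulus_const !mulr_gt0 ?exprn_gt0 // addr_gt0 // mulr_gt0.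
apply: hole_filling_const_gt0 => //; first by rewrite divr_gt0 // addr_gt0.
by rewrite ltr_pdivrMr ?addr_gt0 // mul1r; lra.
Qed.

(** With an annular cutoff, subsolution_cutoff bounds the energy of f in a ball
    by its energy in an annulus around it, with a constant that need not be
    small; adding the same multiple of the energy in the ball to both sides
    fills the hole.  For widths below the size of an edge the inequality is
    trivial. *)
Lemma caccioppoli x a b f :
  0 <= a -> a < b ->
  (forall z, 0 <= f z) ->
  (forall z, z \in ball x b -> f z <= markov_op K f z) ->
  EE (ball x a) f <= caccioppoli_const * (b - a) `^ (- theta) *
    \sum_(z in ball x b) f z ^+ 2 * pi z.
Proof.
move=> a0 ab f0 fK; have CD0 := doubling_gt0 mk vd x.
set X := \sum_(z in _) _; set A := annulus_const C2' CD.
have mono t t' : t <= t' -> \sum_(z in ball x t) f z ^+ 2 * pi z <=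
    \sum_(z in ball x t') f z ^+ 2 * pi z.
  move=> tt'; rewrite [leLHS]big_mkcond [leRHS]big_mkcond; apply: ler_sum => z _.
  have h0 : 0 <= f z ^+ 2 * pi z by rewrite mulr_ge0 ?sqr_ge0 ?(mk_pi_ge0 mk).
  by case: ifPn => [/(gball_le tt') -> //|_]; case: ifP.
have X0 : 0 <= X.
  by apply: sumr_ge0 => z _; rewrite mulr_ge0 ?sqr_ge0 ?(mk_pi_ge0 mk).
have A0 : 0 < A.
  by rewrite /A /annulus_const !mulr_gt0 ?exprn_gt0 // addr_gt0 // mulr_gt0.
set kap := A / (1 + A).
have kap0 : 0 < kap by rewrite divr_gt0 //; lra.
have kap1 : kap < 1 by rewrite ltr_pdivrMr; lra.
have p7 : 0 < (7 : R) `^ theta by rewrite powR_gt0.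
have -> : caccioppoli_const * (b - a) `^ (- theta) * X =
  hole_filling_const theta kap * (4 * 7 `^ theta * X) * (b - a) `^ (- theta).
  by rewrite /caccioppoli_const -/A -/kap; ring.
pose Z t := EE (ball x t) f.
apply: (@hole_filling R theta kap Z a b _ (EE (ball x b) f)) => //.
- by rewrite mulr_ge0 // mulr_ge0 // ltW.
- by move=> t _ tb; apply: (energy_on_subset mk); apply: gball_le; rewrite ltW.
move=> t t' at_ tt' t'b; pose s := (t' - t) / 7.
have s0 : 0 < s by rewrite /s; lra.
have sE : 7 `^ theta * (t' - t) `^ (- theta) = s `^ (- theta).
  have -> : t' - t = 7 * s by rewrite /s; lra.
  by rewrite powRM ?(ltW s0) // mulrA powRN mulfV ?mul1r //.
have -> : 4 * 7 `^ theta * X * (t' - t) `^ (- theta) = 4 * (s `^ (- theta) * X).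
  by rewrite -sE; ring.
have Zt' : 0 <= Z t' by apply: (energy_on_ge0 mk).
have sX0 : 0 <= s `^ (- theta) * X by rewrite mulr_ge0 ?powR_ge0.
have [s1|s1] := leP 1 s; last first.
  apply: (@le_trans _ _ (4 * (s `^ (- theta) * X))); last first.
    by rewrite lerDr mulr_ge0 // ltW.
  apply: le_trans (energy_on_trivial _ _) _; rewrite ler_pM2l //.
  apply: le_trans (mono t b _) _; first by lra.
  rewrite -/X ler_peMl // powRN invf_ge1 ?powR_gt0 //.
  have : s `^ theta <= 1 `^ theta by apply: ge0_ler_powR; rewrite ?nnegrE ?ltW.
  by rewrite powR1.
pose r := t + 4 * s.
have r0 : 0 <= r by rewrite /r; lra.
have [phi [phi1 phi0 hphi]] := annular_cutoff mk C20 cs vd x s1 r0.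
have rt' : r + 3 * s = t' by rewrite /r /s; lra.
have rt : r - 4 * s = t by rewrite /r; lra.
have sub z : z \in ball x (r + 2 * s) -> f z <= markov_op K f z.
  by move=> zB; apply: fK; apply: gball_le zB; lra.
have h1 := le_trans (subsolution_cutoff f0 sub phi0) (hphi f).
rewrite rt' rt -/(Z t) -/(Z t') -/A in h1.
have h2 : Z t <= DD (fun z => phi z * f z) (fun z => phi z * f z).
  apply: (@le_trans _ _ (EE (ball x r) f)).
    by apply: (energy_on_subset mk); apply: gball_le; rewrite /r; lra.
  apply: le_trans (energy_on_dirichlet mk (ball x r) _).
  by apply: (energy_on_le mk) => z u zB uB; rewrite !phi1 // !mul1r.
have h3 : s `^ (- theta) * \sum_(z in ball x t') f z ^+ 2 * pi z <= s `^ (- theta) * X.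
  by rewrite ler_wpM2l ?powR_ge0 // mono // ltW.
have h4 : (1 + A) * Z t <= A * Z t' + A * (s `^ (- theta) * X).
  have := ler_wpM2l (ltW A0) h3; move: h1 h2; lra.
have A1 : 0 < 1 + A by lra.
have h5 : Z t <= kap * Z t' + kap * (s `^ (- theta) * X).
  rewrite -(ler_pM2l A1) (le_trans h4) // le_eqVlt; apply/orP; left; apply/eqP.
  by rewrite /kap; field; rewrite lt0r_neq0.
by apply: (le_trans h5); rewrite lerD2l ler_wpM2r //; lra.
Qed.

End Caccioppoli.

(** * Volume sums *)

Section VolumeSums.

Variables (R : realType) (V : finType) (e : rel V).
Variables (K : V -> V -> R) (pi : V -> R).
Hypothesis mk : markov_kernel e K pi.
Variables (theta CD : R).
Hypothesis theta2 : 2 <= theta.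
Hypothesis vd : condVD e pi CD.

Local Notation ball := (gball e).
Local Notation vol := (gvol e pi).
Local Notation D := ((gdiam e)%:R : R).

(** The order of magnitude of the effective resistance between B(y,4^k/2) and
    the complement of B(y,4^k). *)
Definition annulus_resistance (y : V) (k : nat) : R :=
  (4 ^+ k) `^ theta / vol y (4 ^+ k).

Definition resistance_sum (y : V) (n : nat) : R :=
  \sum_(0 <= k < n) annulus_resistance y k.

Lemma powR_expr (a : R) k : 0 <= a -> (a ^+ k) `^ theta = (a `^ theta) ^+ k.
Proof.
move=> a0; elim: k => [|k IH]; first by rewrite !expr0 powR1.
by rewrite !exprS powRM ?exprn_ge0 // IH.
Qed.

Lemma theta_gt0 : 0 < theta. Proof. by have := theta2; lra. Qed.

Lemma four_powR_ge16 : 16 <= 4 `^ theta :> R.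
Proof.
have -> : 16 = 4 `^ 2 :> R by rewrite powR_mulrn // expr2; lra.
by apply: ler_powR => //; lra.
Qed.

Lemma annulus_resistance_ge0 y k : 0 <= annulus_resistance y k.
Proof. by rewrite divr_ge0 ?powR_ge0 // ltW // (gvol_gt0 mk) // exprn_ge0. Qed.

Lemma inv_gvol_root_le y s n : 0 <= s -> s `^ theta <= n%:R ->
  (vol y (n%:R `^ theta^-1))^-1 <= (vol y s)^-1.
Proof.
move=> s0 sn; rewrite lef_pV2 ?posrE ?(gvol_gt0 mk) ?powR_ge0 //.
apply: (gvol_mono mk).
have -> : s = (s `^ theta) `^ theta^-1.
  by rewrite -powRrM mulfV ?powRr1 // lt0r_neq0 // theta_gt0.
by apply: ge0_ler_powR; rewrite ?nnegrE ?invr_ge0 ?(ltW theta_gt0) ?powR_ge0.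
Qed.

Lemma inv_gvol_root_ge y s n : 0 <= s -> n%:R <= s `^ theta ->
  (vol y s)^-1 <= (vol y (n%:R `^ theta^-1))^-1.
Proof.
move=> s0 sn; rewrite lef_pV2 ?posrE ?(gvol_gt0 mk) ?powR_ge0 //.
apply: (gvol_mono mk).
have -> : s = (s `^ theta) `^ theta^-1.
  by rewrite -powRrM mulfV ?powRr1 // lt0r_neq0 // theta_gt0.
by apply: ge0_ler_powR; rewrite ?nnegrE ?invr_ge0 ?(ltW theta_gt0) ?powR_ge0.
Qed.

Lemma volume_sumE C y : volume_sum e pi theta C y = C * volume_sum e pi theta 1 y.
Proof. by rewrite /volume_sum mulr_sumr; apply: eq_bigr => n _; rewrite mul1r. Qed.

Lemma diam_le_volume_sum y : D `^ theta <= volume_sum e pi theta 1 y.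
Proof.
rewrite /volume_sum; set N := Num.truncn _.
apply: (@le_trans _ _ (\sum_(0 <= n < N.+1) 1)).
  rewrite sumr_const_nat subn0; have := truncnS_gt (2 * D `^ theta).
  by rewrite -/N; have := powR_ge0 D theta; lra.
apply: ler_sum => n _; rewrite ler_pdivlMr ?(gvol_gt0 mk) ?powR_ge0 //.
by rewrite mul1r (gvol_le1 mk).
Qed.

Local Notation partial y N := (\sum_(0 <= n < N) (vol y (n%:R `^ theta^-1))^-1).

(** The integers n between 4^((J-1) theta) and 4^(J theta) number at least half
    of 4^(J theta), and each contributes at least 1/V(y,4^J). *)
Lemma resistance_le_partial y J :
  resistance_sum y J.+1 <= 2 * partial y (Num.truncn ((4 `^ theta) ^+ J : R)).+1.
Proof.
have q16 := four_powR_ge16; set q : R := 4 `^ theta in q16 *.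
have w0 (n : nat) : 0 <= (vol y (n%:R `^ theta^-1))^-1.
  by rewrite invr_ge0 ltW // (gvol_gt0 mk) // powR_ge0.
elim: J => [|J IH].
  rewrite /resistance_sum big_nat1 /annulus_resistance !expr0 powR1 mul1r.
  rewrite big_nat_recl // mulrDr.
  have h1 : (vol y 1)^-1 <= (vol y (0%:R `^ theta^-1))^-1.
    by apply: inv_gvol_root_ge => //; rewrite powR1.
  have : 0 <= \sum_(0 <= n < Num.truncn (1 : R)) (vol y (n.+1%:R `^ theta^-1))^-1.
    exact: sumr_ge0.
  by have := w0 0%N; lra.
rewrite /resistance_sum big_nat_recr //= -/(resistance_sum y J.+1).
set N := Num.truncn (q ^+ J) in IH; set N' := Num.truncn (q ^+ J.+1).
have qJ : 1 <= q ^+ J by rewrite exprn_ege1 //; lra.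
have NN' : (N <= N')%N.
  by apply: le_truncn; rewrite exprS ler_peMl //; lra.
rewrite (big_cat_nat (n := N.+1)) //= mulrDr lerD //.
apply: (@le_trans _ _ (2 * \sum_(N.+1 <= n < N'.+1) (vol y (4 ^+ J.+1))^-1)); last first.
  rewrite ler_pM2l // !big_nat; apply: ler_sum => n /andP[_ nN].
  apply: inv_gvol_root_ge; rewrite ?exprn_ge0 // powR_expr //.
  apply: (@le_trans _ _ N'%:R); first by rewrite ler_nat -ltnS.
  by rewrite truncn_le exprn_ge0 //; lra.
rewrite sumr_const_nat subSS -[X in 2 * X]mulr_natl mulrA.
rewrite /annulus_resistance powR_expr // -/q.
rewrite ler_wpM2r ?invr_ge0 ?(ltW (gvol_gt0 mk _ _)) ?exprn_ge0 //.
rewrite natrB //.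
have N'l : q ^+ J.+1 < N'%:R + 1 by rewrite natr1; apply: truncnS_gt.
have Nl : N%:R <= q ^+ J by rewrite truncn_le; lra.
have qJ0 : 0 <= q ^+ J by lra.
by have := ler_wpM2r qJ0 q16; move: N'l; rewrite exprS; lra.
Qed.

(** Beyond 4^(J theta) each term is at most 1/V(y,4^J).  The term n = 0 is
    1/pi(y), which doubling compares to 1/V(y,1). *)
Lemma partial_le_resistance y J N :
  N%:R <= 3 * (4 `^ theta) ^+ J.+1 :> R ->
  partial y N <= 3 * 4 `^ theta * CD * resistance_sum y J.+1.
Proof.
have CD0 := doubling_gt0 mk vd y; have CD1 := doubling_ge1 mk vd y.
have q16 := four_powR_ge16; set q : R := 4 `^ theta in q16 *.
have a0 := annulus_resistance_ge0 y.
elim: J N => [|J IH] N hN.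
  have wle (n : nat) : (vol y (n%:R `^ theta^-1))^-1 <= CD * (vol y 1)^-1.
    rewrite -(invrK CD) -invfM lef_pV2 ?posrE ?mulr_gt0 ?invr_gt0 ?(gvol_gt0 mk) ?powR_ge0 //.
    rewrite ler_pdivrMl //; apply: (@le_trans _ _ (CD * vol y (1 / 2))).
      have := @vd y (1 / 2); have -> : 2 * (1 / 2) = 1 :> R by lra.
      by apply; lra.
    rewrite ler_pM2l //; apply: (gvol_sub mk) => z /(gball_small mk) ->; last by lra.
    by rewrite gball_center // powR_ge0.
  apply: (@le_trans _ _ (\sum_(0 <= n < N) CD * (vol y 1)^-1)).
    by apply: ler_sum => n _.
  rewrite sumr_const_nat subn0 -[leLHS]mulr_natl.
  rewrite /resistance_sum big_nat1 /annulus_resistance !expr0 powR1 mul1r mulrA.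
  rewrite ler_wpM2r ?invr_ge0 ?(ltW (gvol_gt0 mk _ _)) //.
  by rewrite ler_pM2r //; move: hN; rewrite expr1.
pose N0 := minn N (Num.truncn (3 * q ^+ J.+1)).
have qJ : 1 <= q ^+ J.+1 by rewrite exprn_ege1 //; lra.
have N0N : (N0 <= N)%N by rewrite geq_minl.
rewrite /resistance_sum big_nat_recr //= -/(resistance_sum y J.+1).
rewrite (big_cat_nat (n := N0)) //= mulrDr lerD //.
  apply: IH; apply: (@le_trans _ _ (Num.truncn (3 * q ^+ J.+1))%:R).
    by rewrite ler_nat geq_minr.
  by rewrite truncn_le; lra.
apply: (@le_trans _ _ (\sum_(N0 <= n < N) (vol y (4 ^+ J.+1))^-1)).
  rewrite !big_nat; apply: ler_sum => n /andP[N0n nN].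
  apply: inv_gvol_root_le; rewrite ?exprn_ge0 // powR_expr // -/q.
  have : (Num.truncn (3 * q ^+ J.+1) <= n)%N.
    by move: N0n; rewrite geq_min leqNgt nN.
  rewrite -(ler_nat R) => hn; have := truncnS_gt (3 * q ^+ J.+1).
  rewrite -[(Num.truncn _).+1%:R]natr1; lra.
rewrite sumr_const_nat -[leLHS]mulr_natl /annulus_resistance powR_expr // -/q mulrA.
rewrite ler_wpM2r ?invr_ge0 ?(ltW (gvol_gt0 mk _ _)) ?exprn_ge0 //.
apply: (@le_trans _ _ N%:R); first by rewrite ler_nat leq_subr.
apply: (le_trans hN).
have -> : 3 * q * CD * q ^+ J.+1 = CD * (3 * q ^+ J.+2) by rewrite [q ^+ J.+2]exprS; ring.
by rewrite ler_peMl // mulr_ge0 // exprn_ge0 //; lra.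
Qed.

Hypothesis D0 : (0 < gdiam e)%N.

Definition diam_scale : nat := trunc_log 4 (gdiam e).

Lemma diam_scale_le : 4 ^+ diam_scale <= D.
Proof. by rewrite -natrX ler_nat trunc_logP. Qed.

Lemma diam_scale_gt : D < 4 ^+ diam_scale.+1.
Proof. by rewrite -natrX ltr_nat trunc_log_ltn. Qed.

Lemma diam_scale_powR_le : (4 `^ theta) ^+ diam_scale <= D `^ theta.
Proof.
rewrite -powR_expr //.
by apply: ge0_ler_powR; rewrite ?nnegrE ?exprn_ge0 ?(ltW theta_gt0) ?diam_scale_le.
Qed.

Lemma diam_scale_powR_ge : D `^ theta <= (4 `^ theta) ^+ diam_scale.+1.
Proof.
rewrite -powR_expr //.
apply: ge0_ler_powR; rewrite ?nnegrE ?exprn_ge0 ?(ltW theta_gt0) //.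
exact/ltW/diam_scale_gt.
Qed.

Lemma diam_powR_ge1 : 1 <= D `^ theta.
Proof.
have : D `^ 0 <= D `^ theta by rewrite ler_powR ?(ltW theta_gt0) // ler1n.
by rewrite powRr0.
Qed.

Lemma resistance_le_volume_sum y :
  resistance_sum y diam_scale.+1 <= 2 * volume_sum e pi theta 1 y.
Proof.
apply: (le_trans (resistance_le_partial y diam_scale)); rewrite ler_pM2l //.
rewrite /volume_sum; under [leRHS]eq_bigr do rewrite div1r.
set N := (Num.truncn _).+1; set N' := (Num.truncn (2 * _)).+1.
have NN' : (N <= N')%N.
  by apply: le_truncn; have := diam_scale_powR_le; have := diam_powR_ge1; lra.
rewrite [leRHS](big_cat_nat (n := N)) //= lerDl; apply: sumr_ge0 => n _.
by rewrite invr_ge0 ltW // (gvol_gt0 mk) // powR_ge0.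
Qed.

Lemma volume_sum_le_resistance y :
  volume_sum e pi theta 1 y <= 3 * 4 `^ theta * CD * resistance_sum y diam_scale.+1.
Proof.
rewrite /volume_sum; under eq_bigr do rewrite div1r.
apply: partial_le_resistance; set x := 2 * _.
have x0 : 0 <= x by rewrite mulr_ge0 ?powR_ge0.
have : (Num.truncn x)%:R <= x by rewrite truncn_le.
rewrite -[(Num.truncn _).+1%:R]natr1 /x; have := diam_scale_powR_ge; have := diam_powR_ge1; lra.
Qed.

End VolumeSums.

(** * The upper bound *)

(** The scale of de_giorgi depends on the constants of the conditions only, so
    that it can be chosen before the graph. *)
Lemma small_scale (R : realType) (theta a b : R) :
  1 <= theta -> 0 < a -> 0 < b ->
  exists2 m, (3 <= m)%N & a * (2^-1 ^+ m) `^ theta <= b.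
Proof.
move=> th1 a0 b0.
have half0 : 0 <= 2^-1 :> R by rewrite invr_ge0.
have half1 : 2^-1 < 1 :> R by rewrite invf_lt1 // ltr1n.
have [n hn] := geometric_small a half0 half1 b0.
exists (n + 3)%N; first by rewrite leq_addl.
apply: le_trans (ltW hn); rewrite ler_pM2l //.
have h0 k : 0 < (2^-1 : R) ^+ k by rewrite exprn_gt0.
have h1 k : (2^-1 : R) ^+ k <= 1 by rewrite exprn_ile1 //; lra.
apply: le_trans (ge1r_powR _ th1) _; first by rewrite h0 h1.
by rewrite exprD ler_piMr // ltW.
Qed.

Section UpperBound.

Variables (R : realType) (V : finType) (e : rel V).
Variables (K : V -> V -> R) (pi : V -> R).
Hypothesis mk : markov_kernel e K pi.
Variables (theta CP CD : R).
Hypothesis theta2 : 2 <= theta.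
Hypothesis CP0 : 0 < CP.
Hypothesis pinq : condPI e K pi theta CP.
Hypothesis vd : condVD e pi CD.

Local Notation ball := (gball e).
Local Notation vol := (gvol e pi).
Local Notation EE := (energy_on K pi).
Local Notation DD := (dirichlet K pi).
Local Notation D := ((gdiam e)%:R : R).
Local Notation S := (volume_sum e pi theta 1).

Variables (y : V) (g : V -> R).
Hypothesis gK : forall z, z != y -> g z <= 1 + markov_op K g z.
Hypothesis gy : g y = 0.

(** On at least half of each ball B(y,4^(n-1)), g is at most a sum of annulus
    resistances: if g rose by much more than the resistance of the n-th
    annulus, the layer in between would carry too much energy.  The chain
    starts at the radius 1/4, where the ball is {y} and g = 0. *)
Lemma hitting_chain n :
  vol y (4 ^+ n / 4) / 2 <=
  \sum_(z in ball y (4 ^+ n / 4 : R) |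
    g z <= 32 * CP * CD ^+ 2 * resistance_sum e pi theta y n) pi z.
Proof.
have CD0 := doubling_gt0 mk vd y; have CD1 := doubling_ge1 mk vd y.
elim: n => [|n IH].
  rewrite /resistance_sum big_geq // mulr0 expr0.
  have -> : \sum_(z in ball y (1 / 4 : R) | g z <= 0) pi z = vol y (1 / 4).
    rewrite big_mkcondr; apply: eq_bigr => z zy.
    by rewrite (gball_small mk _ zy) ?gy ?lexx //; lra.
  have : 0 < vol y (1 / 4) by apply: (gvol_gt0 mk); lra.
  by lra.
have rE : 4 ^+ n.+1 / 4 = 4 ^+ n :> R by rewrite exprS; field.
rewrite rE; set r : R := 4 ^+ n.
have r0 : 0 < r by rewrite exprn_gt0.
set t := _ * resistance_sum e pi theta y n in IH.
set t' := _ * resistance_sum e pi theta y n.+1.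
pose del := 32 * CP * CD ^+ 2 * annulus_resistance e pi theta y n.
have t'E : t' = t + del.
  by rewrite /t' /resistance_sum big_nat_recr //= mulrDr.
have C0 : 0 < 32 * CP * CD ^+ 2 by rewrite mulr_gt0 ?exprn_gt0 // mulr_gt0.
have v0 : 0 < vol y r by rewrite (gvol_gt0 mk) // ltW.
have P0 : 0 < r `^ theta by rewrite powR_gt0.
have del0 : 0 < del.
  by rewrite mulr_gt0 // divr_gt0.
have t0 : 0 <= t.
  rewrite mulr_ge0 ?(ltW C0) //; apply: sumr_ge0 => k _.
  exact: (annulus_resistance_ge0 mk).
(* Half of the smaller ball has at least this mass, as its radius is r/4. *)
pose m := vol y r / (2 * CD ^+ 2).
have m0 : 0 <= m by rewrite divr_ge0 ?(ltW v0) // mulr_ge0 // exprn_ge0 ?(ltW CD0).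
have CD2 : 1 <= CD ^+ 2 by rewrite exprn_ege1.
have mle : m <= vol y r / 2.
  by rewrite /m invfM mulrA ler_piMr ?divr_ge0 ?(ltW v0) // invf_le1 //; lra.
rewrite leNgt; apply/negP => half.
have half' : vol y r / 2 <= \sum_(z in ball y r | ~~ (g z <= t')) pi z.
  have : vol y r = \sum_(z in ball y r | g z <= t') pi z +
    \sum_(z in ball y r | ~~ (g z <= t')) pi z by rewrite /gvol (bigID (fun z => g z <= t')).
  by lra.
have low : m <= \sum_(z in ball y r | (z \in ball y (4 ^+ n / 4 : R)) && (g z <= t)) pi z.
  apply: (@le_trans _ _ (vol y (4 ^+ n / 4) / 2)).
    have : vol y r <= CD ^+ 2 * vol y (4 ^+ n / 4).
      apply: (gvol_comparable mk vd); first by rewrite divr_gt0.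
      by apply: gball_le; rewrite -/r expr2; lra.
    rewrite /m ler_pdivrMr; last by rewrite mulr_gt0 // exprn_gt0.
    by move=> h; apply: (le_trans h); lra.
  apply: (le_trans IH); rewrite le_eqVlt; apply/orP; left; apply/eqP.
  apply: eq_bigl => z; apply/andP/and3P => [[zB gz]|[_ zB gz]]; split=> //.
  by apply: gball_le zB; rewrite -/r; lra.
have tt' : t <= t' by rewrite t'E lerDl ltW.
pose f z := clip t t' (g z).
have flow z : z \in ball y r -> (z \in ball y (4 ^+ n / 4 : R)) && (g z <= t) -> f z <= t.
  by move=> _ /andP[_ gz]; rewrite /f clip_low.
have fhigh z : z \in ball y r -> ~~ (g z <= t') -> t' <= f z.
  by move=> _; rewrite -ltNge => /ltW gz; rewrite /f clip_high.
have := poincare_two_sets mk CP0 pinq r0 tt' m0 flow fhigh low (le_trans mle half').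
apply/negP; rewrite -ltNge.
have := le_trans (energy_on_dirichlet mk (ball y r) f) (layer_energy mk gK gy t0 tt').
rewrite t'E [t + del]addrC addrK => en.
apply: (@le_lt_trans _ _ (4 * CP * r `^ theta * (2 * del))).
  by rewrite ler_wpM2l // mulr_ge0 ?powR_ge0 // mulr_ge0 // ltW.
have -> : del ^+ 2 * m = del * (16 * CP * r `^ theta).
  have delE : del * vol y r = 32 * CP * CD ^+ 2 * r `^ theta.
    by rewrite /del /annulus_resistance -/r -mulrA divfK // lt0r_neq0.
  have -> : del ^+ 2 * m = del * (del * vol y r) / (2 * CD ^+ 2).
    by rewrite /m expr2 !mulrA.
  by rewrite delE; field; rewrite lt0r_neq0.
have := mulr_gt0 del0 (mulr_gt0 CP0 P0).
lra.
Qed.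

Hypothesis D0 : (0 < gdiam e)%N.
Variable m : nat.
Hypothesis m3 : (3 <= m)%N.
Hypothesis m_small : 6 * CP * CD ^+ 2 * 4 * (2^-1 ^+ m) `^ theta <= (4 * CD)^-1.

Definition upper_const : R :=
  32 * CP * CD ^+ 2 * (2 + 4 `^ theta) + 1 + 8 * CD ^+ (m + 2) * (12 * CP) ^+ 2.

(** The chain bounds g on half of the graph; De Giorgi's iteration at the
    scale of the diameter then bounds it everywhere. *)
Lemma hitting_upper x : g x <= upper_const * S y.
Proof.
have CD0 := doubling_gt0 mk vd y; have th0 := theta_gt0 theta2.
pose J := diam_scale e; have DJ := diam_scale_gt R e.
have Dth1 := diam_powR_ge1 theta2 D0.
have Dpos : 0 < D by rewrite ltr0n.
set Dth := D `^ theta in Dth1.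
have full u r z : D <= r -> z \in ball u r by apply: gball_diam.
pose t := 32 * CP * CD ^+ 2 * resistance_sum e pi theta y J.+2.
have half : 1 / 2 <= \sum_(z | g z <= t) pi z.
  have := hitting_chain J.+2.
  have DJ' : D <= 4 ^+ J.+2 / 4.
    by rewrite exprS [4 * _]mulrC mulfK ?pnatr_eq0 // ltW.
  rewrite (gvol_full mk) // => /le_trans; apply; rewrite le_eqVlt; apply/orP; left.
  by apply/eqP/eq_bigl => z; rewrite full.
have t0 : 0 <= t.
  rewrite !mulr_ge0 ?exprn_ge0 ?(ltW CP0) ?(ltW CD0) //; apply: sumr_ge0 => k _.
  exact: (annulus_resistance_ge0 mk).
have SD : Dth <= S y by apply: (diam_le_volume_sum mk).
have tS : t <= 32 * CP * CD ^+ 2 * (2 + 4 `^ theta) * S y.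
  rewrite -mulrA ler_pM2l ?mulr_gt0 ?exprn_gt0 //.
  rewrite /resistance_sum big_nat_recr //= -/(resistance_sum e pi theta y J.+1) mulrDl lerD //.
    exact: (resistance_le_volume_sum mk).
  rewrite /annulus_resistance (gvol_full mk) ?divr1 ?(ltW DJ) //.
  rewrite exprS powRM ?exprn_ge0 // ler_pM2l ?powR_gt0 //; apply: le_trans SD.
  by rewrite powR_expr //; apply: diam_scale_powR_le.
pose f z := pos_part (g z - t).
have fE := excess_energy mk gK gy t0.
rewrite -/f in fE.
pose X := \sum_z f z ^+ 2 * pi z.
have f0 z : 0 <= f z by apply: pos_part_ge0.
have X0 : 0 <= X by apply: sumr_ge0 => z _; rewrite mulr_ge0 ?sqr_ge0 ?(mk_pi_ge0 mk).
pose Y := \sum_z f z * pi z.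
have Y0 : 0 <= Y by apply: sumr_ge0 => z _; rewrite mulr_ge0 ?(mk_pi_ge0 mk).
have XY : X <= 12 * CP * Dth * Y.
  have half' : vol x D / 2 <= \sum_(z in ball x D | f z == 0) pi z.
    rewrite (gvol_full mk) //; apply: (le_trans half).
    rewrite [leLHS]big_mkcond [leRHS]big_mkcond; apply: ler_sum => z _.
    rewrite full //=; case: ifPn => gz.
      by rewrite /f pos_part_eq0 ?eqxx // subr_le0.
    by case: ifP; rewrite ?(mk_pi_ge0 mk).
  have := poincare_half mk CP0 pinq Dpos half'.
  rewrite (eq_bigl predT) => [h|z]; last by rewrite full.
  apply: (le_trans h).
  have -> : 12 * CP * Dth * Y = 6 * CP * Dth * (2 * Y) by ring.
  rewrite ler_wpM2l ?mulr_ge0 ?(ltW CP0) ?powR_ge0 //.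
  by apply: le_trans fE; apply: (energy_on_dirichlet mk).
have YX : Y ^+ 2 <= X.
  have := sum_cauchy_schwarz f (fun=> 1) (mk_pi_ge0 mk).
  under eq_bigr do rewrite mulr1.
  rewrite -/Y -/X; under [X in _ <= _ * X]eq_bigr do rewrite expr1n mul1r.
  by rewrite (mk_pi_sum1 mk) mulr1.
(* X <= A Y and Y^2 <= X give Y <= A and X <= A^2. *)
pose A := 12 * CP * Dth.
have A0 : 0 < A by rewrite !mulr_gt0 //; lra.
have YA : Y <= A.
  have [->|Yn] := eqVneq Y 0; first exact: ltW.
  have Yp : 0 < Y by rewrite lt_def Yn.
  by rewrite -(ler_pM2r Yp) -expr2; apply: (le_trans YX).
have XA : X <= A ^+ 2 by apply: (le_trans XY); rewrite expr2 ler_pM2l.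
pose Lam := 8 * CD ^+ (m + 2).
have Lam0 : 0 < Lam by rewrite mulr_gt0 // exprn_gt0.
(* k^2 must exceed Lam A^2 = L D^(2 theta); (1+L)^2 >= L avoids a root. *)
pose L := Lam * (12 * CP) ^+ 2.
have L0 : 0 <= L by rewrite mulr_ge0 ?sqr_ge0 // ltW.
pose k := (1 + L) * Dth.
have k0 : 0 < k by rewrite mulr_gt0 //; lra.
have kD : Dth <= k by rewrite /k ler_peMl //; lra.
suff : g x - t <= k.
  move=> gk; apply: (@le_trans _ _ (t + k)); first by lra.
  rewrite /upper_const -/Lam -/L -addrA mulrDl lerD //.
  by rewrite /k ler_wpM2l //; lra.
apply: (@de_giorgi _ _ _ _ _ mk _ _ _ CP0 pinq vd x D (fun z => g z - t) k 4 m) => //.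
- move=> j; set q : R := 2^-1 ^+ j => /=.
  have q0 : 0 < q by rewrite exprn_gt0.
  have q1 : q <= 1 by rewrite exprn_ile1 //; lra.
  pose s := t + k * (1 - q / 2).
  have s0 : 0 <= s by rewrite addr_ge0 // mulr_ge0 ?(ltW k0) //; lra.
  have sE z : g z - t - k * (1 - q / 2) = g z - s by rewrite /s; ring.
  apply: (@le_trans _ _ (2 * \sum_z pos_part (g z - s) * pi z)).
    apply: le_trans (excess_energy mk gK gy s0).
    apply: le_trans (energy_on_dirichlet mk (ball x (D * (1 + 3 / 4 * q))) _).
    by apply: (energy_on_le mk) => z u _ _; rewrite !sE.
  (* Chebyshev gives a factor 1/(kq); it is at most (Dq)^-theta because k is at
     least D^theta and q^theta <= q. *)
  have Dq : 1 <= k * q * (D * q) `^ (- theta).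
    rewrite powRN ler_pdivlMr ?powR_gt0 ?mulr_gt0 // mul1r powRM ?(ltW q0) //.
    apply: ler_pM; rewrite ?powR_ge0 //.
    by apply: (ge1r_powR _ _); rewrite ?q0 ?q1 //; have := theta2; lra.
  apply: (@le_trans _ _ (2 * (k * q * (D * q) `^ (- theta)) *
     \sum_z pos_part (g z - s) * pi z)).
    rewrite -mulrA ler_pM2l // ler_peMl // sumr_ge0 // => z _.
    by rewrite mulr_ge0 ?pos_part_ge0 ?(mk_pi_ge0 mk).
  have -> : 2 * (k * q * (D * q) `^ (- theta)) * (\sum_z pos_part (g z - s) * pi z) =
     4 * (D * q) `^ (- theta) * (k * (q / 2) * \sum_z pos_part (g z - s) * pi z) by field.
  rewrite ler_wpM2l ?mulr_ge0 ?powR_ge0 // mulr_sumr [leRHS]big_mkcond.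
  apply: ler_sum => z _; rewrite full; last first.
    by rewrite ler_peMr ?(ltW Dpos) //; lra.
  rewrite mulrA ler_wpM2r ?(mk_pi_ge0 mk) //.
  have kq : 0 <= k * (q / 2) by rewrite mulr_ge0 ?divr_ge0 ?(ltW k0) ?(ltW q0).
  have [gs|gs] := leP (g z - s) 0; first by rewrite pos_part_eq0 // mulr0 sqr_ge0.
  have uE : g z - t - k * (1 - q) = (g z - s) + k * (q / 2) by rewrite /s; field.
  rewrite uE (pos_part_id (ltW gs)) pos_part_id; last by rewrite addr_ge0 // ltW.
  move: gs kq; set a := g z - s; set b := k * (q / 2) => a0 b0.
  by nra.
rewrite (gvol_full mk) ?mulr1; last by lra.
rewrite (eq_bigl predT) => [|z]; last by rewrite full //; lra.
rewrite -/Lam -/X; apply: le_trans (ler_wpM2l (ltW Lam0) XA) _.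
have -> : Lam * A ^+ 2 = L * Dth ^+ 2 by rewrite /A /L; ring.
rewrite /k exprMn ler_wpM2r ?sqr_ge0 //; nra.
Qed.

End UpperBound.

(** * The lower bound *)

Lemma ln_tangent (R : realType) (a b : R) :
  0 < a -> 0 < b -> ln b <= ln a + (b - a) / a.
Proof.
move=> a0 b0; rewrite -lerBlDl -ln_div ?posrE //.
have -> : b / a = 1 + (b - a) / a by field; rewrite lt0r_neq0.
by apply: le_ln1Dx; rewrite ltr_pdivlMr //; lra.
Qed.

(** With a = p^2, b = q^2 and p >= q, the logarithmic increment is
    2 ln(p/q) <= 2(p-q)/q, while -(a-b)(1/a-1/b) = ((p-q)/q)^2 ((p+q)/p)^2. *)
Lemma log_increment_le (R : realType) (a b : R) : 0 < a -> 0 < b ->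
  (ln a - ln b) ^+ 2 <= - 4 * ((a - b) * (a^-1 - b^-1)).
Proof.
wlog ab : a b / b <= a => [W|] a0 b0.
  have [|/ltW ba] := leP b a; first by move=> ab; apply: W.
  have := W b a ba b0 a0.
  have -> : (ln b - ln a) ^+ 2 = (ln a - ln b) ^+ 2 by ring.
  by have -> : (b - a) * (b^-1 - a^-1) = (a - b) * (a^-1 - b^-1) by ring.
pose p := Num.sqrt a; pose q := Num.sqrt b.
have p0 : 0 < p by rewrite sqrtr_gt0.
have q0 : 0 < q by rewrite sqrtr_gt0.
have pE : a = p ^+ 2 by rewrite sqr_sqrtr // ltW.
have qE : b = q ^+ 2 by rewrite sqr_sqrtr // ltW.
have qp : q <= p by apply: ler_wsqrtr.
have lnE (c : R) : 0 < c -> ln (c ^+ 2) = 2 * ln c by move=> c0; rewrite lnXn // mulr_natl.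
rewrite pE qE !lnE //.
have l0 : 0 <= ln p - ln q by rewrite subr_ge0 ler_ln.
have l1 : ln p - ln q <= (p - q) / q by rewrite lerBlDl; apply: ln_tangent.
have -> : - 4 * ((p ^+ 2 - q ^+ 2) * ((p ^+ 2)^-1 - (q ^+ 2)^-1)) =
    4 * (((p - q) / q) ^+ 2 * ((p + q) / p) ^+ 2).
  by field; rewrite !lt0r_neq0.
have -> : (2 * ln p - 2 * ln q) ^+ 2 = 4 * (ln p - ln q) ^+ 2 by ring.
have pq1 : 1 <= ((p + q) / p) ^+ 2.
  by rewrite exprn_ege1 // ler_pdivlMr // mul1r lerDl ltW.
rewrite ler_pM2l //.
apply: (@le_trans _ _ (((p - q) / q) ^+ 2)).
  by rewrite ler_sqr ?nnegrE // divr_ge0 ?(ltW q0) // subr_ge0.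
by rewrite ler_peMr ?sqr_ge0.
Qed.

(** If a, b > 0, the difference of the two sides is (qa - pb)^2/(ab).  A height
    is allowed to vanish where the cutoff does, with the convention 1/0 = 0;
    this occurs at y. *)
Lemma quotient_increment_le (R : realType) (a b p q : R) :
  0 <= a -> 0 <= b -> (p != 0 -> 0 < a) -> (q != 0 -> 0 < b) ->
  (a - b) * (p ^+ 2 / a - q ^+ 2 / b) <= (p - q) ^+ 2.
Proof.
move=> a0 b0 pa qb; rewrite -subr_ge0.
have [p0|/pa {}pa] := eqVneq p 0; have [q0|/qb {}qb] := eqVneq q 0.
- by rewrite p0 q0 expr0n /= !mul0r subrr mulr0 subr0 sqr_ge0.
- rewrite p0 expr0n /= mul0r !sub0r sqrrN.
  have -> : q ^+ 2 - (a - b) * - (q ^+ 2 / b) = q ^+ 2 * (a / b).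
    by field; rewrite lt0r_neq0.
  by rewrite mulr_ge0 ?sqr_ge0 ?divr_ge0.
- rewrite q0 expr0n /= mul0r !subr0.
  have -> : p ^+ 2 - (a - b) * (p ^+ 2 / a) = p ^+ 2 * (b / a).
    by field; rewrite lt0r_neq0.
  by rewrite mulr_ge0 ?sqr_ge0 ?divr_ge0.
have -> : (p - q) ^+ 2 - (a - b) * (p ^+ 2 / a - q ^+ 2 / b) =
    (q * a - p * b) ^+ 2 / (a * b).
  by field; rewrite !lt0r_neq0.
by rewrite divr_ge0 ?sqr_ge0 ?mulr_ge0.
Qed.

Section LowerBound.

Variables (R : realType) (V : finType) (e : rel V).
Variables (K : V -> V -> R) (pi : V -> R).
Hypothesis mk : markov_kernel e K pi.
Variables (theta CP CD C1' C2' eps : R).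
Hypothesis theta2 : 2 <= theta.
Hypothesis CP0 : 0 < CP.
Hypothesis C20 : 0 < C2'.
Hypothesis pinq : condPI e K pi theta CP.
Hypothesis vd : condVD e pi CD.
Hypothesis cs : condCS e K pi theta C1' C2' eps.

Implicit Types (x z u : V) (r lam : R).

Local Notation ball := (gball e).
Local Notation vol := (gvol e pi).
Local Notation EE := (energy_on K pi).
Local Notation DD := (dirichlet K pi).
Local Notation D := ((gdiam e)%:R : R).
Local Notation S := (volume_sum e pi theta 1).
Local Notation T := (resistance_sum e pi theta).
Local Notation Cc := (3 * C2' + 2).

Lemma Cc_gt0 : 0 < Cc. Proof. by rewrite addr_gt0 // mulr_gt0. Qed.

Variables (y : V) (h : V -> R).
Hypothesis hK : forall z, z != y -> h z = 1 + markov_op K h z.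
Hypothesis hy : h y = 0.
Hypothesis h0 : forall z, 0 <= h z.

Lemma hitting_ge1 z : z != y -> 1 <= h z.
Proof.
move=> zy; rewrite hK // lerDl; apply: sumr_ge0 => u _.
by rewrite mulr_ge0 ?(mk_ge0 mk).
Qed.

Lemma hitting_gt0 z : z != y -> 0 < h z.
Proof. by move=> zy; have := hitting_ge1 zy; lra. Qed.

(** The hitting time is the potential of a unit flow entering uniformly and
    leaving at y. *)
Lemma hitting_dirichlet f : DD h f = 2 * (\sum_z f z * pi z - f y).
Proof.
pose w z := (h z - markov_op K h z) * pi z.
have w1 z : z != y -> w z = pi z.
  by move=> zy; rewrite /w {1}(hK zy) addrK mul1r.
have wy : w y = pi y - 1.
  have : DD h (fun=> 1) = 0.
    by rewrite /dirichlet big1 // => z _; rewrite big1 // => u _; rewrite subrr mulr0 mul0r.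
  rewrite (dirichletE mk) => /eqP; rewrite mulf_eq0 pnatr_eq0 /= => /eqP.
  rewrite (eq_bigr w) => [|z _]; last by rewrite mul1r.
  rewrite (bigD1 y) //= (eq_bigr pi) => [|z]; last exact: w1.
  by have := mk_pi_sum1 mk; rewrite (bigD1 y) //=; lra.
rewrite (dirichletE mk); congr (_ * _).
rewrite (eq_bigr (fun z => f z * w z)) => [|z _]; last by rewrite -mulrA.
rewrite (bigD1 y) //= wy [in RHS](bigD1 y) //=.
rewrite [X in _ + X](eq_bigr (fun z => f z * pi z)) => [|z zy]; last by rewrite w1.
ring.
Qed.

(** Resistances in series add up: the gradients of the cutoffs around y at the
    radii 4^k live on disjoint sets of edges, so stacking the cutoffs adds the
    energies.  The support is described with a margin of one edge, which makes
    it empty for n = 0. *)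
Lemma stacked_cutoffs n : exists F : V -> R,
  [/\ forall z, F z != 0 -> (gdist e y z)%:R + 1 <= 4 ^+ n / 2 :> R,
      F y = T y n,
      (\sum_z F z * pi z) * (4 `^ theta - 1) <= (4 `^ theta) ^+ n &
      DD F F <= Cc * CD * T y n].
Proof.
have CD0 := doubling_gt0 mk vd y; have q16 := four_powR_ge16 theta2.
elim: n => [|n [F [Fsupp Fy Fsum FE]]].
  exists (fun=> 0); split; rewrite /resistance_sum ?big_geq //.
  - by move=> z; rewrite eqxx.
  - by rewrite big1 ?mul0r // => z _; rewrite mul0r.
  - by rewrite mulr0 /dirichlet big1 // => z _; rewrite big1 // => u _; rewrite subrr !mul0r.
pose r : R := 4 ^+ n; have r0 : 0 < r by rewrite exprn_gt0.
have r1 : 1 <= r by rewrite exprn_ege1 // ler1n.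
have [sg [sg01 sg1 sg0] sgE] := cutoff_energy mk (theta_gt0 theta2) C20 cs y r0.
pose a := annulus_resistance e pi theta y n.
have a0 : 0 <= a by apply: (annulus_resistance_ge0 mk).
have TS : T y n.+1 = T y n + a by rewrite /resistance_sum big_nat_recr.
have v0 : 0 < vol y r by rewrite (gvol_gt0 mk) // ltW.
have P0 : 0 < r `^ theta by rewrite powR_gt0.
exists (fun z => F z + a * sg z); split.
- move=> z; have [Fz|Fz] := eqVneq (F z) 0; last first.
    by have := Fsupp z Fz; rewrite -/r exprS -/r; lra.
  rewrite Fz add0r mulf_eq0 negb_or => /andP[_ sz].
  have : z \in ball y r by apply: contraNT sz => /sg0 ->.
  by rewrite in_gball exprS -/r; lra.
- by rewrite Fy sg1 ?mulr1 // gball_center // divr_ge0 // ltW.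
- have -> : \sum_z (F z + a * sg z) * pi z = \sum_z F z * pi z + a * \sum_z sg z * pi z.
    by rewrite mulr_sumr -big_split; apply: eq_bigr => z _ /=; ring.
  have sgm : \sum_z sg z * pi z <= vol y r.
    rewrite /gvol [leRHS]big_mkcond; apply: ler_sum => z _.
    case: ifPn => [_|/sg0 ->]; last by rewrite mul0r.
    by rewrite ler_piMl ?(mk_pi_ge0 mk) //; case/andP: (sg01 z).
  have aV : a * \sum_z sg z * pi z <= (4 `^ theta) ^+ n.
    apply: le_trans (ler_wpM2l a0 sgm) _.
    by rewrite /a /annulus_resistance -/r divfK ?lt0r_neq0 // /r powR_expr.
  have q1 : 0 <= 4 `^ theta - 1 by lra.
  by have := ler_wpM2r q1 aV; rewrite exprS; lra.
have cross : DD F sg = 0.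
  rewrite /dirichlet big1 // => z _; rewrite big1 // => u _.
  have [->|c0] := eqVneq (conductance K pi z u) 0; first by rewrite mulr0.
  have c0' : conductance K pi u z != 0 by rewrite (conductance_sym mk).
  have inside x x' : F x != 0 -> conductance K pi x x' != 0 -> sg x = 1 /\ sg x' = 1.
    move=> /Fsupp; rewrite -/r => Fx cx; split; apply: sg1; first by rewrite in_gball; lra.
    have xB : x \in ball y (r / 2 - 1) by rewrite in_gball; lra.
    by apply: gball_le (gball_neighbour mk xB cx); lra.
  have [Fz|Fz] := eqVneq (F z) 0; last first.
    by have [-> ->] := inside z u Fz c0; rewrite subrr mulr0 mul0r.
  have [Fu|Fu] := eqVneq (F u) 0; last first.
    by have [-> ->] := inside u z Fu c0'; rewrite subrr mulr0 mul0r.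
  by rewrite Fz Fu subrr !mul0r.
have -> : DD (fun z => F z + a * sg z) (fun z => F z + a * sg z) =
    DD F F + 2 * a * DD F sg + a * (a * DD sg sg).
  rewrite /dirichlet !mulr_sumr -!big_split; apply: eq_bigr => z _ /=.
  by rewrite !mulr_sumr -!big_split; apply: eq_bigr => u _ /=; ring.
rewrite cross mulr0 addr0 TS mulrDr lerD //.
rewrite [leRHS]mulrC ler_wpM2l //.
apply: le_trans (ler_wpM2l a0 sgE) _.
rewrite mulrCA ler_pM2l ?Cc_gt0 //.
apply: (@le_trans _ _ (a * (r `^ (- theta) * (CD * vol y r)))).
  by rewrite ler_wpM2l // ler_wpM2l ?powR_ge0 ?vd.
rewrite /a /annulus_resistance -/r powRN le_eqVlt; apply/orP; left; apply/eqP.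
by field; rewrite !lt0r_neq0.
Qed.

Hypothesis D0 : (0 < gdiam e)%N.
Local Notation J := (diam_scale e).
Local Notation Dth := (D `^ theta).

(** Cauchy-Schwarz between h and the stacked cutoffs F, with E(h,h) = 2 mean(h)
    and E(h,F) = 2 (mean(F) - T); the mean of F is at most 2 D^theta. *)
Lemma hitting_mean_ge :
  4 * Dth <= T y J.+1 -> T y J.+1 <= 2 * Cc * CD * \sum_z h z * pi z.
Proof.
move=> DT; have CD0 := doubling_gt0 mk vd y; have q16 := four_powR_ge16 theta2.
have [F [_ Fy Fsum FE]] := stacked_cutoffs J.+1.
set t := T y J.+1 in DT Fy FE *.
have Dth1 := diam_powR_ge1 theta2 D0; have DthJ := diam_scale_powR_le theta2 D0.
set M := \sum_z F z * pi z in Fsum.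
have MD : M <= 2 * Dth.
  set q := 4 `^ theta in q16 Fsum DthJ.
  have q1 : 0 < q - 1 by lra.
  rewrite -(ler_pM2r q1); apply: (le_trans Fsum); rewrite exprS.
  have qn0 : 0 <= q ^+ J by rewrite exprn_ge0 //; lra.
  apply: (@le_trans _ _ ((2 * (q - 1)) * q ^+ J)); first by rewrite ler_wpM2r //; lra.
  have -> : 2 * Dth * (q - 1) = (2 * (q - 1)) * Dth by ring.
  by rewrite ler_wpM2l //; lra.
have hF := hitting_dirichlet F; rewrite -/M Fy in hF.
have hh := hitting_dirichlet h; rewrite hy subr0 in hh.
have := dirichlet_cauchy_schwarz mk h F; rewrite hF hh.
set Mh := \sum_z h z * pi z => csq.
have Mh0 : 0 <= Mh by apply: sumr_ge0 => z _; rewrite mulr_ge0 ?(mk_pi_ge0 mk).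
have tp : 0 < t by lra.
have tt : t ^+ 2 <= (2 * (M - t)) ^+ 2.
  have -> : (2 * (M - t)) ^+ 2 = (2 * (t - M)) ^+ 2 by ring.
  by rewrite ler_sqr ?nnegrE; lra.
have h2 : 2 * Mh * DD F F <= 2 * Mh * (Cc * CD * t).
  by rewrite ler_wpM2l // mulr_ge0.
rewrite -(ler_pM2r tp) -expr2; apply: (le_trans tt); apply: (le_trans csq).
by apply: (le_trans h2); rewrite le_eqVlt; apply/orP; left; apply/eqP; ring.
Qed.

(** If the mean of h is comparable to its maximum, then h is large on a set of
    definite mass, and the Poincare inequality at the scale of the diameter
    makes it large on half of any given ball of comparable volume. *)
Lemma hitting_large_on_half x r (c1 U m : R) :
  0 < c1 -> 0 < U -> 0 < m ->
  c1 * T y J.+1 <= \sum_z h z * pi z ->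
  (forall z, h z <= U * T y J.+1) ->
  m <= c1 / (2 * U) -> m <= vol x r / 2 ->
  32 * CP * Dth < c1 * m * T y J.+1 ->
  vol x r / 2 <= \sum_(z in ball x r | c1 / 4 * T y J.+1 <= h z) pi z.
Proof.
move=> c10 U0 m0; set t := T y J.+1 => mean sup mU mv big.
have Dpos : 0 < D by rewrite ltr0n.
have Dth0 : 0 < Dth by rewrite powR_gt0.
have full u z : z \in ball u D by apply: gball_diam.
have t0 : 0 < t.
  have cm : 0 < c1 * m by rewrite mulr_gt0.
  by rewrite -(pmulr_rgt0 _ cm); apply: le_lt_trans big; rewrite !mulr_ge0 ?(ltW CP0) ?powR_ge0.
pose a := c1 / 4 * t; pose b := c1 / 2 * t.
have c1t : 0 < c1 * t by rewrite mulr_gt0.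
have a0 : 0 <= a by rewrite /a; lra.
have ab : a <= b by rewrite /a /b; lra.
set p := \sum_(z in ball x D | b <= h z) pi z.
have pE : p = \sum_(z | b <= h z) pi z by apply: eq_bigl => z; rewrite full.
have mp : m <= p.
  apply: (le_trans mU); rewrite ler_pdivrMr ?mulr_gt0 //.
  have : \sum_z h z * pi z <= b + U * t * p.
    rewrite pE mulr_sumr [X in _ + X]big_mkcond.
    have bE : b = \sum_z b * pi z by rewrite -mulr_sumr (mk_pi_sum1 mk) mulr1.
    rewrite [X in X + _]bE -big_split; apply: ler_sum => z _ /=.
    have pz := mk_pi_ge0 mk z; case: ifPn => hz.
      have := ler_wpM2r pz (sup z); have : 0 <= b by lra.
      by move=> b0; have := mulr_ge0 b0 pz; lra.
    by rewrite addr0 ler_wpM2r // ltW // ltNge.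
  move=> hm; rewrite -(ler_pM2r t0); have := le_trans mean hm.
  by rewrite /b; lra.
rewrite leNgt; apply/negP => half.
have half' : vol x r / 2 <= \sum_(z in ball x D | h z <= a) pi z.
  have E : vol x r = \sum_(z in ball x r | a <= h z) pi z +
    \sum_(z in ball x r | ~~ (a <= h z)) pi z by rewrite /gvol (bigID (fun z => a <= h z)).
  apply: (@le_trans _ _ (\sum_(z in ball x r | ~~ (a <= h z)) pi z)); first by lra.
  rewrite [leLHS]big_mkcond [leRHS]big_mkcond; apply: ler_sum => z _.
  rewrite full /=; case: ifPn => [/andP[_]|_]; last by case: ifP; rewrite ?(mk_pi_ge0 mk).
  by rewrite -ltNge => /ltW ->.
pose f z := clip a b (h z).
have flow z : z \in ball x D -> h z <= a -> f z <= a.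
  by move=> _ hz; rewrite /f clip_low.
have fhigh z : z \in ball x D -> b <= h z -> b <= f z.
  by move=> _ hz; rewrite /f clip_high.
have := poincare_two_sets mk CP0 pinq Dpos ab (ltW m0) flow fhigh (le_trans mv half') mp.
apply/negP; rewrite -ltNge.
have hK' z : z != y -> h z <= 1 + markov_op K h z by move=> /hK ->.
have en := le_trans (energy_on_dirichlet mk (ball x D) f) (layer_energy mk hK' hy a0 ab).
apply: (@le_lt_trans _ _ (4 * CP * Dth * (2 * (b - a)))).
  by rewrite ler_wpM2l // mulr_ge0 ?powR_ge0 // mulr_ge0 // ltW.
have ba : 0 < b - a by rewrite /a /b; lra.
have -> : 4 * CP * Dth * (2 * (b - a)) = (b - a) * (8 * CP * Dth) by ring.
rewrite expr2 -[ltRHS]mulrA ltr_pM2l //.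
have -> : b - a = c1 * t / 4 by rewrite /a /b; field.
by move: big; lra.
Qed.

(** Moser's logarithmic estimate: the equation of h is tested with sigma^2/h,
    where sigma is a cutoff around x.  The right-hand side 1 of the equation
    yields the mean of 1/h, the left-hand side the energy of ln h. *)
Lemma hitting_log_energy x r : 0 < r -> y \notin ball x (4 * r) ->
  2 * (\sum_(z in ball x (2 * r)) (h z)^-1 * pi z) +
  EE (ball x (2 * r)) (fun z => ln (h z)) / 4 <=
  Cc * CD ^+ 2 * (4 * r) `^ (- theta) * vol x (2 * r).
Proof.
move=> r0 yB; have r40 : 0 < 4 * r by lra.
have [sg [sg01 sg1 sg0] sgE] := cutoff_energy mk (theta_gt0 theta2) C20 cs x r40.
have r2E : 4 * r / 2 = 2 * r by field.
rewrite r2E in sg1.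
have {}sgE : DD sg sg <= Cc * CD ^+ 2 * (4 * r) `^ (- theta) * vol x (2 * r).
  apply: (le_trans sgE).
  have -> : Cc * CD ^+ 2 * (4 * r) `^ (- theta) * vol x (2 * r) =
    Cc * ((4 * r) `^ (- theta) * (CD ^+ 2 * vol x (2 * r))) by ring.
  rewrite ler_pM2l ?Cc_gt0 // ler_wpM2l ?powR_ge0 //.
  apply: (gvol_comparable mk vd); first by lra.
  by apply: gball_le; rewrite expr2; lra.
apply: le_trans sgE.
have nY z : sg z != 0 -> 0 < h z.
  move=> sz; apply: hitting_gt0; apply: contraNneq sz => ->.
  by rewrite sg0.
pose f z := sg z ^+ 2 / h z.
have fsum : \sum_(z in ball x (2 * r)) (h z)^-1 * pi z <= \sum_z f z * pi z - f y.
  rewrite /f hy invr0 mulr0 subr0 [leLHS]big_mkcond; apply: ler_sum => z _.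
  case: ifPn => zB; first by rewrite sg1 // expr1n mul1r.
  by rewrite mulr_ge0 ?(mk_pi_ge0 mk) // divr_ge0 ?sqr_ge0.
apply: (@le_trans _ _ (DD h f + EE (ball x (2 * r)) (fun z => ln (h z)) / 4)).
  by rewrite lerD2r hitting_dirichlet ler_pM2l.
rewrite energy_onE mulr_suml /dirichlet -big_split; apply: ler_sum => z _ /=.
rewrite mulr_suml -big_split; apply: ler_sum => u _ /=.
have c0 := conductance_ge0 mk z u.
case: ifPn => [/andP[zB uB]|_]; last first.
  rewrite mul0r addr0 ler_wpM2r // -expr2.
  by apply: quotient_increment_le => //; apply: nY.
have hz : 0 < h z by apply: nY; rewrite sg1 // oner_eq0.
have hu : 0 < h u by apply: nY; rewrite sg1 // oner_eq0.
have := ler_wpM2r c0 (log_increment_le hz hu).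
rewrite /f !sg1 // expr1n !div1r subrr mul0r mul0r; lra.
Qed.

(** Chebyshev's inequality for 1/h. *)
Lemma hitting_large_local x r : 0 < r -> y \notin ball x (4 * r) ->
  vol x (2 * r) / 2 <=
  \sum_(z in ball x (2 * r) | (4 * r) `^ theta / (Cc * CD ^+ 2) <= h z) pi z.
Proof.
move=> r0 yB; have := hitting_log_energy r0 yB.
have CD0 := doubling_gt0 mk vd y; have C0 := Cc_gt0.
set A := Cc * CD ^+ 2; have A0 : 0 < A by rewrite mulr_gt0 // exprn_gt0.
set P := (4 * r) `^ theta; have P0 : 0 < P by rewrite powR_gt0; lra.
have := energy_on_ge0 mk (ball x (2 * r)) (fun z => ln (h z)).
set E := EE _ _ => E0; set X := \sum_(z in _) _ => hX.
have v0 : 0 < vol x (2 * r) by rewrite (gvol_gt0 mk) //; lra.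
have {}hX : P / A * X <= vol x (2 * r) / 2.
  have PA : 0 < P / A by rewrite divr_gt0.
  have : 2 * X <= A * (4 * r) `^ (- theta) * vol x (2 * r) by lra.
  move=> /(ler_wpM2l (ltW PA)); rewrite powRN -/P.
  have -> : P / A * (A / P * vol x (2 * r)) = vol x (2 * r) by field; rewrite !lt0r_neq0.
  by lra.
have split : vol x (2 * r) = \sum_(z in ball x (2 * r) | P / A <= h z) pi z +
    \sum_(z in ball x (2 * r) | ~~ (P / A <= h z)) pi z.
  by rewrite /gvol (bigID (fun z => P / A <= h z)).
suff : \sum_(z in ball x (2 * r) | ~~ (P / A <= h z)) pi z <= P / A * X by lra.
rewrite /X mulr_sumr big_mkcondr; apply: ler_sum => z zB.
have zy : z != y.
  by apply: contraNneq yB => <-; apply: gball_le zB; lra.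
have hz := hitting_gt0 zy.
have pz := mk_pi_ge0 mk z.
rewrite mulrA; case: ifPn => [|_]; last first.
  by rewrite mulr_ge0 // mulr_ge0 ?invr_ge0 // divr_ge0 ?ltW.
rewrite -ltNge => lt_h; rewrite ler_peMl //.
by rewrite ler_pdivlMr // mul1r ltW.
Qed.

Variable m : nat.
Hypothesis m3 : (3 <= m)%N.
Hypothesis m_small :
  6 * CP * CD ^+ 2 * (4 `^ theta * caccioppoli_const theta C2' CD) * (2^-1 ^+ m) `^ theta <=
  (4 * CD)^-1.

Definition harnack_const : R := 1 + 8 * CD ^+ (m + 2) * (24 * CP * Cc * CD ^+ 2).

(** Weak Harnack inequality.  The positive part of ln(lambda/h) is a
    subsolution away from y; it vanishes on half of a ball and its energy is
    bounded, hence so is its mean square and, by De Giorgi, its value at x.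
    The value of h at y is raised to 1 so that the logarithm is finite. *)
Lemma hitting_weak_harnack x r lam :
  0 < r -> y \notin ball x (4 * r) -> 0 < lam ->
  vol x (2 * r) / 2 <= \sum_(z in ball x (2 * r) | lam <= h z) pi z ->
  lam * expR (- harnack_const) <= h x.
Proof.
move=> r0 yB lam0 half; have CD0 := doubling_gt0 mk vd y.
have th0 := theta_gt0 theta2.
pose k := harnack_const.
have B0 : 0 <= 8 * CD ^+ (m + 2) * (24 * CP * Cc * CD ^+ 2).
  by rewrite ltW // !mulr_gt0 ?exprn_gt0 ?Cc_gt0.
have k1 : 1 <= k by rewrite /k /harnack_const lerDl.
have xy : x != y by apply: contraNneq yB => <-; rewrite gball_center //; lra.
pose H z := if z == y then 1 else h z.
have H0 z : 0 < H z by rewrite /H; case: eqVneq => // /hitting_gt0.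
have HK z : z != y -> markov_op K H z <= H z.
  move=> zy; rewrite /H (negPf zy) (hK zy).
  apply: (@le_trans _ _ (\sum_u (K z u * h u + K z u * (u == y)%:R))).
    apply: ler_sum => u _; case: eqVneq => [->|_]; first by rewrite hy mulr0 add0r mulr1.
    by rewrite mulr0 addr0.
  rewrite big_split /= addrC lerD2r -[leRHS](mk_sum1 mk z); apply: ler_sum => u _.
  by rewrite ler_piMr ?(mk_ge0 mk) //; case: eqP.
have Hh z : z \in ball x (4 * r) -> H z = h z.
  by move=> zB; rewrite /H; case: eqVneq => // zy; case/negP: yB; rewrite -zy.
have lnsuper z : z != y -> \sum_u K z u * ln (H u) <= ln (H z).
  move=> zy.
  apply: (@le_trans _ _ (\sum_u K z u * (ln (H z) + (H u - H z) / H z))).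
    by apply: ler_sum => u _; rewrite ler_wpM2l ?(mk_ge0 mk) // ln_tangent.
  have -> : \sum_u K z u * (ln (H z) + (H u - H z) / H z) =
      (\sum_u K z u) * ln (H z) + (markov_op K H z - (\sum_u K z u) * H z) / H z.
    rewrite /markov_op !mulr_suml -sumrB mulr_suml -big_split.
    by apply: eq_bigr => u _ /=; ring.
  rewrite (mk_sum1 mk) !mul1r gerDl; apply: mulr_le0_ge0; last by rewrite invr_ge0 ltW.
  by rewrite subr_le0 HK.
pose v z := ln lam - ln (H z).
have sub c z : z != y -> pos_part (v z - c) <= markov_op K (fun u => pos_part (v u - c)) z.
  move=> zy; rewrite {1}/pos_part ge_max; apply/andP; split; last first.
    by apply: sumr_ge0 => u _; rewrite mulr_ge0 ?(mk_ge0 mk) ?pos_part_ge0.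
  apply: (@le_trans _ _ (\sum_u K z u * (v u - c))); last first.
    by apply: ler_sum => u _; rewrite ler_wpM2l ?(mk_ge0 mk) ?pos_part_ge.
  have -> : \sum_u K z u * (v u - c) =
      (\sum_u K z u) * (ln lam - c) - \sum_u K z u * ln (H u).
    by rewrite mulr_suml -sumrB; apply: eq_bigr => u _; rewrite /v; ring.
  by rewrite (mk_sum1 mk) mul1r /v; have := lnsuper z zy; lra.
have vx : v x <= k; last first.
  have -> : h x = H x by rewrite /H (negPf xy).
  rewrite -ler_ln ?posrE ?mulr_gt0 ?expR_gt0 // lnM ?posrE ?expR_gt0 // expRK.
  by move: vx; rewrite /v /k; lra.
have k0 : 0 < k by lra.
have CP0' := CP0; have C0 := Cc_gt0.
have half' : vol x (2 * r) / 2 <= \sum_(z in ball x (2 * r) | pos_part (v z) == 0) pi z.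
  apply: (le_trans half); rewrite !big_mkcondr; apply: ler_sum => z zB.
  case: ifPn => hz; last by case: ifP; rewrite ?(mk_pi_ge0 mk).
  rewrite pos_part_eq0 ?eqxx // /v subr_le0 ler_ln ?posrE // Hh //.
  by apply: gball_le zB; lra.
have r20 : 0 < 2 * r by lra.
have A0 := poincare_half mk CP0 pinq r20 half'.
apply: (@de_giorgi _ _ _ _ _ mk _ _ _ CP0 pinq vd x r v k
  (4 `^ theta * caccioppoli_const theta C2' CD) m) => //.
- move=> j; set q : R := 2^-1 ^+ j => /=.
  have q0 : 0 < q by rewrite exprn_gt0.
  have q1 : q <= 1 by rewrite exprn_ile1 //; lra.
  pose a := r * (1 + 3 / 4 * q); pose b := r * (1 + q).
  have rq : 0 < r * q by rewrite mulr_gt0.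
  have a0 : 0 <= a by rewrite /a; lra.
  have ab : a < b by rewrite /a /b; lra.
  have b2 : b <= 4 * r by rewrite /b; nra.
  set c := k * (1 - q / 2).
  have subB z : z \in ball x b ->
      pos_part (v z - c) <= markov_op K (fun u => pos_part (v u - c)) z.
    move=> zB; apply: sub; apply: contraNneq yB => <-.
    exact: gball_le zB.
  have := caccioppoli mk th0 C20 cs vd a0 ab (fun z => pos_part_ge0 (v z - c)) subB.
  move=> /le_trans; apply; rewrite -/a -/b.
  have -> : b - a = r * q / 4 by rewrite /a /b; field.
  have cacc0 := ltW (caccioppoli_const_gt0 th0 C20 CD0).
  have -> : (r * q / 4) `^ (- theta) = 4 `^ theta * (r * q) `^ (- theta).
    have {2}-> : r * q = r * q / 4 * 4 by field.
    have s0 : 0 <= r * q / 4 by rewrite divr_ge0 // ltW.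
    by rewrite [in RHS]powRM // !powRN mulrCA mulfV ?mulr1.
  rewrite mulrA [_ * 4 `^ theta]mulrC.
  rewrite ler_wpM2l ?powR_ge0 ?(mulr_ge0 (mulr_ge0 (powR_ge0 _ _) cacc0)) ?powR_ge0 //.
  apply: ler_sum => z _; rewrite ler_wpM2r ?(mk_pi_ge0 mk) //.
  rewrite ler_sqr ?nnegrE ?pos_part_ge0 // /pos_part ge_max !le_max lexx orbT andbT.
  by have -> : v z - c <= v z - k * (1 - q) by rewrite /c lerD2l lerN2; nra.
have v0 : 0 < vol x (2 * r) by rewrite (gvol_gt0 mk) // ltW.
have logE : EE (ball x (2 * r)) (fun z => pos_part (v z)) <=
    EE (ball x (2 * r)) (fun z => ln (h z)).
  apply: (energy_on_le mk) => z u zB uB.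
  apply: le_trans (pos_part_lip _ _) _; rewrite /v !Hh; last 2 first.
  - by apply: gball_le uB; lra.
  - by apply: gball_le zB; lra.
  by rewrite le_eqVlt; apply/orP; left; apply/eqP; ring.
have X0 : 0 <= \sum_(z in ball x (2 * r)) (h z)^-1 * pi z.
  by apply: sumr_ge0 => z _; rewrite mulr_ge0 ?invr_ge0 ?(mk_pi_ge0 mk).
have logE' : EE (ball x (2 * r)) (fun z => ln (h z)) <=
    4 * (Cc * CD ^+ 2 * (4 * r) `^ (- theta) * vol x (2 * r)).
  by have := hitting_log_energy r0 yB; lra.
have P0 : 0 < (2 * r) `^ theta by rewrite powR_gt0.
have scale_le1 : (2 * r) `^ theta * (4 * r) `^ (- theta) <= 1.
  have P4 : 0 < (4 * r) `^ theta by rewrite powR_gt0 //; lra.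
  rewrite powRN ler_pdivrMr // mul1r.
  by apply: ge0_ler_powR; rewrite ?nnegrE ?(ltW th0) //; lra.
set X := \sum_(z in _) _ in A0 *.
have XB : X <= 24 * CP * Cc * CD ^+ 2 * vol x (2 * r).
  apply: (le_trans A0).
  have h1 : 0 <= 6 * CP * (2 * r) `^ theta by rewrite mulr_ge0 ?(ltW P0) // mulr_ge0 // ltW.
  apply: le_trans (ler_wpM2l h1 (le_trans logE logE')) _.
  have -> : 6 * CP * (2 * r) `^ theta *
      (4 * (Cc * CD ^+ 2 * (4 * r) `^ (- theta) * vol x (2 * r))) =
    24 * CP * Cc * CD ^+ 2 * vol x (2 * r) * ((2 * r) `^ theta * (4 * r) `^ (- theta)) by ring.
  have c0 : 0 < 24 * CP * Cc * CD ^+ 2 by rewrite mulr_gt0 ?exprn_gt0 // !mulr_gt0.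
  by rewrite ler_piMr // ltW // mulr_gt0.
have Lam0 : 0 < 8 * CD ^+ (m + 2) by rewrite mulr_gt0 // exprn_gt0.
apply: le_trans (ler_wpM2l (ltW Lam0) XB) _.
rewrite mulrA ler_pM2r // expr2.
apply: (@le_trans _ _ k); last by rewrite ler_peMl // ltW.
by rewrite /k /harnack_const lerDr.
Qed.

End LowerBound.

(** * Survival probabilities and the expected hitting time *)

Section Survival.

Variables (R : realType) (V : finType) (e : rel V).
Variables (K : V -> V -> R) (pi : V -> R).
Hypothesis mk : markov_kernel e K pi.
Variable y : V.

(** The probability that the chain started at z avoids y up to time n. *)
Fixpoint survival (n : nat) (z : V) : R :=
  if z == y then 0
  else if n is n'.+1 then \sum_u K z u * survival n' u else 1.

(** The expectation of min(tau_y, N). *)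
Definition truncated_hitting (N : nat) (z : V) : R :=
  \sum_(0 <= n < N) survival n z.

Lemma survival_ge0 n z : 0 <= survival n z.
Proof.
elim: n z => [|n IH] z /=; case: eqP => // _.
by apply: sumr_ge0 => u _; rewrite mulr_ge0 ?(mk_ge0 mk).
Qed.

Lemma survival_target n : survival n y = 0.
Proof. by case: n => [|n] /=; rewrite eqxx. Qed.

Lemma truncated_hitting_target N : truncated_hitting N y = 0.
Proof. by apply: big1 => n _; apply: survival_target. Qed.

Lemma truncated_hittingS N z : z != y ->
  truncated_hitting N.+1 z = 1 + markov_op K (truncated_hitting N) z.
Proof.
move=> zy; rewrite /truncated_hitting big_nat_recl //=  (negPf zy); congr (_ + _).
rewrite /markov_op; under [RHS]eq_bigr do rewrite mulr_sumr.
by rewrite [RHS]exchange_big.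
Qed.

Lemma truncated_hitting_nd z : nondecreasing_seq (truncated_hitting^~ z).
Proof.
apply/nondecreasing_seqP => N.
by rewrite /truncated_hitting big_nat_recr //= lerDl survival_ge0.
Qed.

Lemma truncated_hitting_sub N z : z != y ->
  truncated_hitting N z <= 1 + markov_op K (truncated_hitting N) z.
Proof.
by move=> zy; rewrite -truncated_hittingS //; apply: truncated_hitting_nd.
Qed.

(** The truncations increase in N and satisfy the equation up to a shift of N,
    which disappears in the limit. *)
Lemma hitting_limit B : (forall N z, truncated_hitting N z <= B) ->
  exists2 h : V -> R,
    (forall z, truncated_hitting^~ z @ \oo --> h z) &
    [/\ forall z, z != y -> h z = 1 + markov_op K h z, h y = 0,
        forall z, 0 <= h z & forall z, h z <= B].
Proof.
move=> tB.
have cv z : cvgn (truncated_hitting^~ z).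
  apply: nondecreasing_is_cvgn; first exact: truncated_hitting_nd.
  by exists B => _ [N _ <-].
exists (fun z => limn (truncated_hitting^~ z)); first by move=> z; apply: cv.
have nonneg z : 0 <= limn (truncated_hitting^~ z).
  apply: limr_ge; first exact: cv.
  by apply: nearW => N; apply: sumr_ge0 => n _; apply: survival_ge0.
split=> //.
- move=> z zy.
  have h1 : (fun N => truncated_hitting N.+1 z) @ \oo --> limn (truncated_hitting^~ z).
    by rewrite (cvg_shiftS (truncated_hitting^~ z)); apply: cv.
  have h2 : (fun N => truncated_hitting N.+1 z) @ \oo -->
      1 + markov_op K (fun u => limn (truncated_hitting^~ u)) z.
    have -> : (fun N => truncated_hitting N.+1 z) =
        (fun N => 1 + \sum_u K z u * truncated_hitting N u).
      by apply/funext => N; rewrite truncated_hittingS.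
    apply: cvgD; first exact: cvg_cst.
    apply: cvg_big => [|u _]; first exact: add_continuous.
    by apply: cvgMr; exact: cv.
  exact: (cvg_unique _ h1 h2).
- have -> : truncated_hitting^~ y = (fun=> 0).
    by apply/funext => N; apply: truncated_hitting_target.
  exact: lim_cst.
- by move=> z; apply: limr_le; [exact: cv | apply: nearW].
Qed.

Variables (d : measure_display) (T : measurableType d) (P : probability T R).
Variables (X : nat -> T -> V) (x : V).
Hypothesis chain : markov_chain K P X x.

Let pr (A : set T) : R := fine (P A).

Lemma prE A : measurable A -> P A = (pr A)%:E.
Proof. by move=> mA; rewrite /pr fineK // fin_num_measure. Qed.

Lemma measurable_state n v : measurable [set w | X n w = v].
Proof. by case: chain => + _ _; apply. Qed.

Lemma measurable_avoid n v : measurable [set w | X n w <> v].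
Proof.
rewrite (_ : [set w | X n w <> v] = ~` [set w | X n w = v]) //.
by apply: measurableC; apply: measurable_state.
Qed.

Lemma measurable_forall_le (n : nat) (Q : nat -> T -> Prop) :
  (forall i, measurable [set w | Q i w]) ->
  measurable [set w | forall i, (i <= n)%N -> Q i w].
Proof.
move=> mQ; rewrite (_ : [set w | _] = \bigcap_(i in `I_n.+1) [set w | Q i w]).
  by apply: bigcap_measurable => [|i _]; [exists 0%N | apply: mQ].
by apply/seteqP; split=> w h i iN; apply: h.
Qed.

Lemma pr_split n A : measurable A ->
  pr A = \sum_v pr (A `&` [set w | X n w = v]).
Proof.
move=> mA.
have split s : uniq s ->
    pr (A `&` [set w | X n w \in s]) = \sum_(v <- s) pr (A `&` [set w | X n w = v]).
  elim: s => [_|v s IH /= /andP[vs us]].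
    rewrite big_nil /pr (_ : [set w | _] = set0) ?setI0 ?measure0 //.
    by apply/seteqP; split.
  have ms : measurable [set w | X n w \in s].
    elim: (s) => [|u t IHt].
      by rewrite (_ : [set w | _] = set0) //; apply/seteqP; split.
    rewrite (_ : [set w | _] = [set w | X n w = u] `|` [set w | X n w \in t]).
      by apply: measurableU => //; apply: measurable_state.
    apply/seteqP; split=> w /=; rewrite inE.
      by case/orP => [/eqP|]; [left|right].
    by case=> [->|->]; rewrite ?eqxx ?orbT.
  have mv := measurable_state n v.
  rewrite big_cons -IH // /pr.
  rewrite (_ : A `&` [set w | X n w \in v :: s] =
    (A `&` [set w | X n w = v]) `|` (A `&` [set w | X n w \in s])); last first.
    rewrite -setIUr; congr (_ `&` _); apply/seteqP; split=> w /=; rewrite inE.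
      by case/orP => [/eqP|]; [left|right].
    by case=> [->|->]; rewrite ?eqxx ?orbT.
  rewrite measureU; [|exact: measurableI|exact: measurableI|].
    by rewrite fineD // fin_num_measure //; apply: measurableI.
  apply/seteqP; split=> w //= [[_ /= Xv] [_ /= Xs]].
  by move: vs; rewrite -Xv Xs.
rewrite -big_enum -split ?enum_uniq // (_ : [set w | _] = setT) ?setIT //.
by apply/seteqP; split=> w //= _; rewrite mem_enum.
Qed.

Let cyl n p := [set w : T | forall i, (i <= n)%N -> X i w = p i].
Let avoid n m := [set w : T | forall i, (i <= m)%N -> X (n + i)%N w <> y].

Lemma measurable_cyl n p : measurable (cyl n p).
Proof.
apply: (@measurable_forall_le n (fun i w => X i w = p i)) => i.
exact: measurable_state.
Qed.

Lemma measurable_avoid_le n m : measurable (avoid n m).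
Proof.
apply: (@measurable_forall_le m (fun i w => X (n + i)%N w <> y)) => i.
exact: measurable_avoid.
Qed.

Lemma pr_cyl_step n p : pr (cyl n.+1 p) = pr (cyl n p) * K (p n) (p n.+1).
Proof.
case: chain => _ _ /(_ n p) h; apply: EFin_inj.
by rewrite EFinM -!prE //; apply: measurable_cyl.
Qed.

(** The chain is specified through its cylinders, so the induction on m has to
    carry the whole past along. *)
Lemma pr_cyl_avoid m n p :
  pr (cyl n p `&` avoid n m) = pr (cyl n p) * survival m (p n).
Proof.
elim: m n p => [|m IH] n p.
  rewrite /survival; case: eqP => pny.
    rewrite mulr0 /pr (_ : _ `&` _ = set0) ?measure0 //.
    apply/seteqP; split=> w //= [cw aw]; apply: (aw 0%N) => //.
    by rewrite addn0 cw.
  rewrite mulr1; congr pr; apply/seteqP; split=> w /=; first by case.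
  by move=> cw; split=> // i; rewrite leqn0 => /eqP ->; rewrite addn0 cw.
rewrite [survival _ _]/=; case: eqP => pny.
  rewrite mulr0 /pr (_ : _ `&` _ = set0) ?measure0 //.
  apply/seteqP; split=> w //= [cw aw]; apply: (aw 0%N) => //.
  by rewrite addn0 cw.
rewrite (pr_split n.+1); last first.
  by apply: measurableI; [apply: measurable_cyl | apply: measurable_avoid_le].
rewrite mulr_sumr; apply: eq_bigr => v _.
pose p' i := if (i <= n)%N then p i else v.
have p'n : p' n = p n by rewrite /p' leqnn.
have p'S : p' n.+1 = v by rewrite /p' ltnn.
have cylE : cyl n p' = cyl n p.
  by apply/seteqP; split=> w cw i iN; have := cw i iN; rewrite /p' iN.
have -> : cyl n p `&` avoid n m.+1 `&` [set w | X n.+1 w = v] =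
    cyl n.+1 p' `&` avoid n.+1 m.
  apply/seteqP; split=> w /=.
    move=> [[cw aw] Xv]; split=> i iN.
      move: iN; rewrite leq_eqVlt ltnS => /orP[/eqP ->|iN]; first by rewrite p'S.
      by rewrite /p' iN cw.
    by rewrite addSnnS; apply: aw.
  move=> [cw aw]; split; last by rewrite cw // p'S.
  split=> [i iN|[|i] iN].
  - by rewrite cw ?(leqW iN) // /p' iN.
  - by rewrite addn0 cw // p'n.
  - by rewrite -addSnnS; apply: aw.
by rewrite IH pr_cyl_step cylE p'n p'S mulrA.
Qed.

Lemma pr_avoid m : P [set w | forall i, (i <= m)%N -> X i w <> y] = (survival m x)%:E.
Proof.
have -> : [set w | forall i, (i <= m)%N -> X i w <> y] = avoid 0 m by [].
have mav := measurable_avoid_le 0 m.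
rewrite prE //; congr EFin.
have c1 : pr (cyl 0 (fun=> x)) = 1.
  rewrite /pr (_ : cyl 0 _ = [set w | X 0%N w = x]).
    by case: chain => _ -> _.
  by apply/seteqP; split=> w /= cw; [apply: cw | move=> i; rewrite leqn0 => /eqP ->].
have := pr_cyl_avoid m 0 (fun=> x); rewrite c1 mul1r => <-.
rewrite (pr_split 0 mav) (bigD1 x) //= big1 ?addr0 => [|v vx].
  congr pr; apply/seteqP; split=> w /= [] h1 h2; split=> //.
    by move=> i; rewrite leqn0 => /eqP ->.
  exact: h1.
have p0 : pr [set w | X 0%N w = v] = 0.
  have := pr_split 0 (@measurableT _ T); rewrite /pr probability_setT /=.
  under eq_bigr do rewrite setTI.
  rewrite (bigD1 x) //=.
  have -> : fine (P [set w | X 0%N w = x]) = 1 by case: chain => _ -> _.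
  move=> /eqP; rewrite addrC -subr_eq subrr eq_sym => /eqP s0.
  by apply: (psumr_eq0P _ s0) => // u _; rewrite fine_ge0.
apply/eqP; rewrite eq_le; apply/andP; split; last by rewrite fine_ge0.
rewrite -p0 /pr fine_le ?fin_num_measure //.
- exact: measurableI mav (measurable_state 0 v).
- exact: measurable_state.
- apply: le_measure; rewrite ?inE; [|exact: measurable_state|by move=> w []].
  exact: measurableI mav (measurable_state 0 v).
Qed.

(** tau is the number of n such that tau > n. *)
Lemma hitting_time_series w :
  hitting_time R X y w =
  (\sum_(0 <= n <oo)
     (\1_[set w | forall i, (i <= n)%N -> X i w <> y] w : R)%:E)%E.
Proof.
set A := fun n => [set w | forall i, (i <= n)%N -> X i w <> y].
have pos n : (0 <= (\1_(A n) w : R)%:E)%E by rewrite lee_fin indicE.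
have [[n0 n0y]|never] := pselect (exists n, X n w = y); last first.
  have A1 n : (\1_(A n) w : R) = 1.
    by rewrite indicE mem_set // => i _ Xi; apply: never; exists i.
  transitivity (+oo%E : \bar R).
    rewrite /hitting_time (_ : [set _ | n in _] = set0) ?ereal_inf0 //.
    by apply/seteqP; split=> // t [n ny _]; case: never; exists n.
  apply/esym/eqP; rewrite -leye_eq leNgt; apply/negP => fin.
  have fin' : (\sum_(0 <= n <oo) (\1_(A n) w : R)%:E)%E \is a fin_num.
    by rewrite ge0_fin_numE // nneseries_ge0.
  pose s := fine (\sum_(0 <= n <oo) (\1_(A n) w : R)%:E)%E.
  have := nneseries_lim_ge (m := 0) (P := predT) (Num.truncn s).+1 (fun n _ _ => pos n).
  rewrite -(fineK fin') -/s (eq_bigr (fun=> 1%:E)) => [|n _]; last by rewrite A1.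
  rewrite sumEFin lee_fin sumr_const_nat subn0 leNgt.
  by rewrite truncnS_gt.
have ex : exists n, X n w == y by exists n0; apply/eqP.
case: (ex_minnP ex) => k /eqP ky kmin.
have Alt n : (\1_(A n) w : R) = (n < k)%N%:R.
  rewrite indicE; congr (_%:R); congr nat_of_bool; apply/idP/idP => [|nk].
    by rewrite inE => An; rewrite ltnNge; apply/negP => kn; apply: (An k).
  rewrite inE => i iN /eqP Xi; have := kmin i Xi.
  by rewrite leqNgt (leq_ltn_trans iN nk).
transitivity (k%:R%:E : \bar R).
  apply/eqP; rewrite eq_le; apply/andP; split.
    by apply: ereal_inf_lbound; exists k.
  apply: le_ereal_inf_tmp => _ [n ny <-]; rewrite lee_fin ler_nat.
  by apply: kmin; apply/eqP.
rewrite (@nneseries_split _ _ 0%N k) //= add0n eseries0; last first.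
  by move=> n kn _; rewrite Alt ltnNge kn.
rewrite adde0 (eq_big_nat _ _ (F2 := fun=> 1%:E)); last first.
  by move=> n /andP[_ nk]; rewrite Alt nk.
by rewrite sumEFin sumr_const_nat subn0.
Qed.

Lemma expected_hitting_timeE :
  expected_hitting_time P X y = (\sum_(0 <= n <oo) (survival n x)%:E)%E.
Proof.
rewrite /expected_hitting_time.
have mA n : measurable [set w | forall i, (i <= n)%N -> X i w <> y].
  apply: (@measurable_forall_le n (fun i w => X i w <> y)) => i.
  exact: measurable_avoid.
under eq_integral do rewrite hitting_time_series.
rewrite integral_nneseries //.
- by apply: eq_eseriesr => n _; rewrite integral_indic // setIT; apply: pr_avoid.
- by move=> n; apply/measurable_EFinP; apply: measurable_indic.
Qed.

Lemma expected_hitting_time_le B :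
  (forall N, truncated_hitting N x <= B) -> (expected_hitting_time P X y <= B%:E)%E.
Proof.
move=> tB; rewrite expected_hitting_timeE; apply: lime_le.
  by apply: is_cvg_nneseries => n _ _; rewrite lee_fin survival_ge0.
by apply: nearW => N; rewrite sumEFin lee_fin; apply: tB.
Qed.

Lemma expected_hitting_time_ge B b :
  (forall N, truncated_hitting N x <= B) ->
  (forall c, (forall N, truncated_hitting N x <= c) -> b <= c) ->
  (b%:E <= expected_hitting_time P X y)%E.
Proof.
move=> tB bsup; have le_oo := expected_hitting_time_le tB.
have ge0 : (0 <= expected_hitting_time P X y)%E.
  by rewrite expected_hitting_timeE nneseries_ge0 // => n _ _; rewrite lee_fin survival_ge0.
have fin : expected_hitting_time P X y \is a fin_num.
  by rewrite ge0_fin_numE //; apply: le_lt_trans le_oo _; rewrite ltry.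
rewrite -(fineK fin) lee_fin; apply: bsup => N.
rewrite -lee_fin fineK // expected_hitting_timeE -sumEFin.
by apply: nneseries_lim_ge => n _ _; rewrite lee_fin survival_ge0.
Qed.

End Survival.

(** * Two-sided bounds *)

Section TwoSidedBounds.

Variables (R : realType) (V : finType) (e : rel V).
Variables (K : V -> V -> R) (pi : V -> R).
Hypothesis mk : markov_kernel e K pi.
Variables (theta CP CD C1' C2' eps : R).
Hypothesis theta2 : 2 <= theta.
Hypothesis CP0 : 0 < CP.
Hypothesis C20 : 0 < C2'.
Hypothesis pinq : condPI e K pi theta CP.
Hypothesis vd : condVD e pi CD.
Hypothesis cs : condCS e K pi theta C1' C2' eps.

Local Notation ball := (gball e).
Local Notation vol := (gvol e pi).
Local Notation D := ((gdiam e)%:R : R).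
Local Notation S := (volume_sum e pi theta 1).
Local Notation T := (resistance_sum e pi theta).
Local Notation Cc := (3 * C2' + 2).

Variables m n : nat.
Hypothesis m3 : (3 <= m)%N.
Hypothesis m_small : 6 * CP * CD ^+ 2 * 4 * (2^-1 ^+ m) `^ theta <= (4 * CD)^-1.

Lemma upper_const_gt0 : 0 < CD -> 0 < upper_const theta CP CD m.
Proof.
move=> CD0; have p4 : 0 < 4 `^ theta by apply: powR_gt0.
have h1 : 0 < 32 * CP * CD ^+ 2 by rewrite mulr_gt0 ?exprn_gt0 // mulr_gt0.
have h2 : 0 < 2 + 4 `^ theta by rewrite addr_gt0.
have h3 : 0 <= 8 * CD ^+ (m + 2) by rewrite mulr_ge0 // exprn_ge0 // ltW.
have := mulr_gt0 h1 h2; have := mulr_ge0 h3 (sqr_ge0 (12 * CP)).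
by rewrite /upper_const; lra.
Qed.

Lemma truncated_hitting_upper y N z :
  truncated_hitting K y N z <= upper_const theta CP CD m * S y.
Proof.
have CD0 := doubling_gt0 mk vd y.
have [D0|D0] := posnP (gdiam e); last first.
  apply: (hitting_upper mk theta2 CP0 pinq vd _ _ D0 m3 m_small).
    by move=> u uy; apply: (truncated_hitting_sub mk).
  exact: truncated_hitting_target.
have -> : z = y.
  apply: (gdist_eq0 (mk_connected mk)); apply/eqP; rewrite -leqn0 -D0.
  exact: gdist_le_diam.
rewrite truncated_hitting_target mulr_ge0 //; first exact/ltW/upper_const_gt0.
by apply: le_trans (diam_le_volume_sum mk theta y); apply: powR_ge0.
Qed.

Variable m' : nat.
Hypothesis m3' : (3 <= m')%N.
Hypothesis m_small' :
  6 * CP * CD ^+ 2 * (4 `^ theta * caccioppoli_const theta C2' CD) * (2^-1 ^+ m') `^ theta <=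
  (4 * CD)^-1.
Variable c0 : R.
Hypothesis c00 : 0 < c0.
Hypothesis n_large : 1 <= 2 ^+ n * (c0 / 4).

Definition mean_const : R := (2 * Cc * CD)^-1.

Definition max_const : R := upper_const theta CP CD m * (3 * 4 `^ theta * CD).

(** Of the whole graph, at least the first fraction has h >= T mean_const/2;
    at least twice the second lies in the ball around x. *)
Definition mass_const : R :=
  Num.min (mean_const / (2 * max_const)) ((CD ^+ n)^-1 / 2).

(** Above this ratio of the resistance to D^theta, the growth of h near y
    dominates what happens at the scale of the diameter. *)
Definition transient_ratio : R := 4 + 32 * CP / (mean_const * mass_const).

Definition lower_const : R :=
  expR (- harnack_const CP CD C2' m') *
  Num.min (mean_const / 4) ((c0 / 2) `^ theta / (Cc * CD ^+ 2) / transient_ratio) /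
  (3 * 4 `^ theta * CD).

Lemma mean_const_gt0 : 0 < CD -> 0 < mean_const.
Proof. by move=> CD0; rewrite invr_gt0 !mulr_gt0 // addr_gt0 // mulr_gt0. Qed.

Lemma max_const_gt0 : 0 < CD -> 0 < max_const.
Proof.
move=> CD0; apply: mulr_gt0 (upper_const_gt0 CD0) _.
by rewrite !mulr_gt0 // powR_gt0.
Qed.

Lemma mass_const_gt0 : 0 < CD -> 0 < mass_const.
Proof.
move=> CD0; rewrite /mass_const lt_min; apply/andP; split.
  by rewrite divr_gt0 ?mean_const_gt0 // mulr_gt0 // max_const_gt0.
by rewrite divr_gt0 // invr_gt0 exprn_gt0.
Qed.

Lemma transient_ratio_gt0 : 0 < CD -> 0 < transient_ratio.
Proof.
move=> CD0; apply: addr_gt0 => //; apply: divr_gt0; first exact: mulr_gt0.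
exact: mulr_gt0 (mean_const_gt0 CD0) (mass_const_gt0 CD0).
Qed.

Lemma lower_const_gt0 : 0 < CD -> 0 < lower_const.
Proof.
move=> CD0; apply: divr_gt0; last by rewrite !mulr_gt0 // powR_gt0.
apply: mulr_gt0; first exact: expR_gt0.
rewrite lt_min; apply/andP; split; first by rewrite divr_gt0 ?mean_const_gt0.
apply: divr_gt0 (transient_ratio_gt0 CD0).
apply: divr_gt0; first by rewrite powR_gt0 // divr_gt0.
by rewrite mulr_gt0 ?exprn_gt0 // addr_gt0 // mulr_gt0.
Qed.

(** Either the resistance seen from y dominates D^theta, and then h is of the
    order of the resistance on most of every large ball; or the two are
    comparable, and then h is of order D^theta near x because leaving a ball
    of radius of order D takes that long.  The weak Harnack inequality carries
    both estimates to the point x. *)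
Lemma hitting_lower x y h :
  (forall z, z != y -> h z = 1 + markov_op K h z) -> h y = 0 ->
  (forall z, 0 <= h z) ->
  (forall z, h z <= upper_const theta CP CD m * S y) ->
  (0 < gdiam e)%N -> c0 * D <= (gdist e x y)%:R ->
  lower_const * S y <= h x.
Proof.
move=> hK hy h0 hB D0 far; have CD0 := doubling_gt0 mk vd y.
have Dpos : 0 < D by rewrite ltr0n.
have C0 : 0 < Cc by rewrite addr_gt0 // mulr_gt0.
have A0 := transient_ratio_gt0 CD0; have mean0 := mean_const_gt0 CD0.
have mass0 := mass_const_gt0 CD0; have max0 := max_const_gt0 CD0.
set W := 3 * 4 `^ theta * CD.
have W0 : 0 < W by rewrite !mulr_gt0 // powR_gt0.
pose t := T y (diam_scale e).+1.
have St : S y <= W * t by apply: (volume_sum_le_resistance mk theta2 vd D0).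
pose r := c0 * D / 8.
have r0 : 0 < r by rewrite divr_gt0 // mulr_gt0.
have r4 : 4 * r = c0 / 2 * D by rewrite /r; field.
have yB : y \notin ball x (4 * r).
  by rewrite in_gball -ltNge r4; apply: lt_le_trans far; have := mulr_gt0 c00 Dpos; lra.
set E := expR (- harnack_const CP CD C2' m').
have E0 : 0 < E by apply: expR_gt0.
set Q := (c0 / 2) `^ theta / (Cc * CD ^+ 2).
have Q0 : 0 < Q.
  by rewrite divr_gt0 ?powR_gt0 ?divr_gt0 // mulr_gt0 // exprn_gt0.
suff main : E * (Num.min (mean_const / 4) (Q / transient_ratio) * t) <= h x.
  apply: le_trans main; rewrite /lower_const -/E -/Q -/W.
  set M := Num.min _ _.
  have M0 : 0 <= M by rewrite le_min; apply/andP; split; exact/ltW/divr_gt0.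
  have -> : E * M / W * S y = E * (M * (S y / W)) by ring.
  by rewrite ler_pM2l // ler_wpM2l // ler_pdivrMr // mulrC.
have t0 : 0 <= t.
  by apply: sumr_ge0 => k _; apply: (annulus_resistance_ge0 mk).
have Dth0 : 0 < D `^ theta by rewrite powR_gt0.
have [big|small] := ltP (transient_ratio * D `^ theta) t.
  have tpos : 0 < t by apply: le_lt_trans big; rewrite mulr_ge0 ?ltW.
  have part : 4 * D `^ theta <= t.
    apply: le_trans (ltW big); rewrite ler_pM2r // lerDl ltW // divr_gt0 ?mulr_gt0 //.
  have bigT : 32 * CP * D `^ theta < mean_const * mass_const * t.
    have mm0 : 0 < mean_const * mass_const by rewrite mulr_gt0.
    rewrite -ltr_pdivrMl //; apply: le_lt_trans big.
    rewrite mulrA ler_pM2r // mulrC lerDr //.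
  have mean : mean_const * t <= \sum_z h z * pi z.
    rewrite /mean_const mulrC ler_pdivrMr ?mulr_gt0 // mulrC.
    exact: (hitting_mean_ge mk theta2 C20 vd cs hK hy h0 D0 part).
  have sup z : h z <= max_const * t.
    apply: (le_trans (hB z)); rewrite /max_const -mulrA ler_pM2l ?upper_const_gt0 //.
  have massle : mass_const <= vol x (2 * r) / 2.
    apply: (@le_trans _ _ ((CD ^+ n)^-1 / 2)); first by rewrite ge_min lexx orbT.
    rewrite ler_pM2r ?invr_gt0 //.
    have cov : {subset ball x D <= ball x (2 ^+ n * (2 * r))}.
      apply: gball_le; have := ler_wpM2r (ltW Dpos) n_large; rewrite /r mul1r; lra.
    have r20 : 0 < 2 * r by rewrite mulr_gt0.
    have := gvol_comparable mk vd r20 cov; rewrite (gvol_full mk) // => vle.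
    have CDn := exprn_gt0 n CD0.
    by rewrite -(ler_pM2l CDn) mulfV // lt0r_neq0.
  have mU : mass_const <= mean_const / (2 * max_const) by rewrite ge_min lexx.
  have half := hitting_large_on_half mk CP0 pinq hK hy D0 mean0 max0 mass0 mean sup
    mU massle bigT.
  have lam0 : 0 < mean_const / 4 * t by rewrite mulr_gt0 // divr_gt0.
  have := hitting_weak_harnack mk theta2 CP0 C20 pinq vd cs hK hy h0 m3' m_small' r0 yB
    lam0 half.
  apply: le_trans; rewrite -/E mulrC ler_pM2r // ler_wpM2r //.
  by rewrite ge_min lexx.
have lam0 : 0 < (4 * r) `^ theta / (Cc * CD ^+ 2).
  by rewrite divr_gt0 ?powR_gt0 ?mulr_gt0 ?exprn_gt0.
have := hitting_weak_harnack mk theta2 CP0 C20 pinq vd cs hK hy h0 m3' m_small' r0 yB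
  lam0 (hitting_large_local mk theta2 C20 vd cs hK hy h0 r0 yB).
apply: le_trans; rewrite -/E mulrC ler_pM2r // r4 powRM ?(ltW Dpos) ?divr_ge0 ?(ltW c00) //.
have -> : (c0 / 2) `^ theta * D `^ theta / (Cc * CD ^+ 2) = Q * D `^ theta.
  by rewrite /Q mulrAC.
apply: (@le_trans _ _ (Q / transient_ratio * t)).
  by rewrite ler_wpM2r // ge_min lexx orbT.
by rewrite -mulrA ler_pM2l // ler_pdivrMl.
Qed.

End TwoSidedBounds.

Theorem theorem5p2 (R : realType) (theta p0 CD CP C1' C2' eps : R)
    (htheta : 2 <= theta) (hp0 : 0 < p0) (hCD : 0 < CD) (hCP : 0 < CP)
    (hC1' : 0 < C1') (hC2' : 0 < C2') (heps : 0 < eps) :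
  exists2 C2 : R, 0 < C2 &
  forall c0 : R, 0 < c0 ->
  exists2 C1 : R, 0 < C1 &
  forall (V : finType) (e : rel V) (K : V -> V -> R) (pi : V -> R),
    markov_kernel e K pi ->
    condE e K p0 ->
    condVD e pi CD ->
    condPI e K pi theta CP ->
    condCS e K pi theta C1' C2' eps ->
  forall (x y : V)
    (d : measure_display) (T : measurableType d) (P : probability T R)
    (X : nat -> T -> V),
    markov_chain K P X x ->
    ((0 < gdiam e)%N -> c0 * (gdiam e)%:R <= (gdist e x y)%:R ->
       ((volume_sum e pi theta C1 y)%:E <= expected_hitting_time P X y)%E) /\
    (expected_hitting_time P X y <= (volume_sum e pi theta C2 y)%:E)%E.
Proof.
have theta1 : 1 <= theta by lra.
have theta0 : 0 < theta by lra.
have small0 : 0 < (4 * CD)^-1 by rewrite invr_gt0 mulr_gt0.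
have base0 : 0 < 6 * CP * CD ^+ 2 by rewrite !mulr_gt0 ?exprn_gt0.
have [m m3 m_small] := small_scale theta1 (mulr_gt0 base0 (ltr0n R 4)) small0.
have cacc0 := caccioppoli_const_gt0 theta0 hC2' hCD.
have cacc4 : 0 < 4 `^ theta * caccioppoli_const theta C2' CD.
  by apply: mulr_gt0 cacc0; apply: powR_gt0.
have [m' m3' m_small'] := small_scale theta1 (mulr_gt0 base0 cacc4) small0.
exists (upper_const theta CP CD m); first exact: upper_const_gt0.
move=> c0 c00.
have [n n_large] : exists n, 1 <= 2 ^+ n * (c0 / 4).
  have half1 : 2^-1 < 1 :> R by rewrite invf_lt1 // ltr1n.
  have c4 : 0 < c0 / 4 by rewrite divr_gt0.
  have half0 : 0 <= 2^-1 :> R by rewrite invr_ge0.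
  have [n /ltW] := geometric_small 1 half0 half1 c4.
  have p2 : 0 < 2 ^+ n :> R by rewrite exprn_gt0.
  by rewrite mul1r exprVn -(ler_pM2l p2) mulfV ?lt0r_neq0 // => hn; exists n.
exists (lower_const theta CP CD C2' m n m' c0); first exact: lower_const_gt0.
move=> V e K pi mk _ vd pinq cs x y d T P X chain.
have tB := truncated_hitting_upper mk htheta hCP pinq vd m3 m_small y.
rewrite (volume_sumE e pi theta (lower_const _ _ _ _ _ _ _ _)).
rewrite (volume_sumE e pi theta (upper_const _ _ _ _)).
split; last by apply: (expected_hitting_time_le mk chain) => N; apply: tB.
move=> D0 far.
have [h hlim [hK hy h0 hB]] := hitting_limit mk tB.
apply: (expected_hitting_time_ge mk chain (B := _)) => [N|c tc]; first exact: tB.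
apply: (@le_trans _ _ (h x)).
  exact: (hitting_lower mk htheta hCP hC2' pinq vd cs m3' m_small' c00 n_large hK hy h0 hB D0 far).
rewrite -(cvg_lim _ (hlim x)) //; apply: limr_le; first by apply: cvgP (hlim x).
exact: nearW.
Qed.
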